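(* Let $F$ be an algebraically closed field of any characteristic $p\ge 0$, let $\mathbf{G}=Sp_{2n}(F)$ and $n=n_1+\cdots+n_k$, where $n_1,\ldots,n_k$ are positive integers. Let $\mathbf{H}=\mathbf{H}_1\times\cdots\times\mathbf{H}_k\subset\mathbf G$, where $\mathbf{H}_i\cong Sp_{2n_i}(F)$ for $i=1,\ldots,k$, embedded naturally. Let $\rho$ be an irreducible representation of $\mathbf{G}$ with $p$-restricted highest weight $\omega=(a_1,\ldots,a_n)$. Then the following are equivalent: (1) for every composition factor $\tau$ of $\rho|_{\mathbf H}$ there is some $i\in\{1,\ldots,k\}$ such that $\tau(\mathbf{H}_i)=1$ (i.e. $\mathbf H_i$ acts trivially in $\tau$); (2) $\sum_{i=1}^n a_i i<k$.
   Context: Natural embedding: the natural symplectic space $F^{2n}$ of $\mathbf G$ is an orthogonal direct sum of non-degenerate subspaces $U_1,\dots,U_k$ with $\dim U_i=2n_i$, and $\mathbf H_i=Sp(U_i)$ acts on $U_i$ and trivially on $U_j$ for $j\ne i$. Representations of algebraic groups are rational. Let $\mathbf{T}$ be the maximal torus of $\mathbf G$ of matrices $t=\mathrm{diag}(t_1,\ldots,t_n,t_n^{-1},\ldots,t_1^{-1})$ with respect to a Witt basis $e_1,\dots,e_{2n}$ ($(e_i,e_{2n+1-i})=1$ for $i\le n$, $(e_i,e_j)=0$ for $j\ne 2n+1-i$), and $\varepsilon_i(t)=t_i$. The fundamental weights (type $C_n$, Bourbaki numbering) are $\omega_i=\varepsilon_1+\cdots+\varepsilon_i$, and $(a_1,\ldots,a_n)$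 denotes the dominant weight $\sum a_i\omega_i$, $a_i\ge0$. If $p>0$, the weight is $p$-restricted if $a_i<p$ for all $i$; if $p=0$ every dominant weight is regarded as $p$-restricted. *)

(* Defs.v *)
From HB Require Import structures.
From mathcomp Require Import all_boot all_order all_algebra.
From mathcomp Require Import mpoly.

Set Implicit Arguments.
Unset Strict Implicit.
Unset Printing Implicit Defensive.

Import GRing.Theory.
Local Open Scope ring_scope.

Definition has_characteristic (F : fieldType) (p : nat) : Prop :=
  (p = 0%N /\ [pchar F] =i pred0) \/ p \in [pchar F].

Section Symplectic.
Variables (F : fieldType) (n : nat).

(* Gram matrix of the Witt basis: in the 0-based numbering of 'I_(n + n), the
   vector paired with e_i is e_(2n-1-i), so each off-diagonal block is plus or
   minus the n x n antidiagonal identity matrix. *)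
Definition witt_gram : 'M[F]_(n + n) :=
  let A : 'M[F]_n := \matrix_(i, j) (j == rev_ord i)%:R in
  block_mx 0 A (- A) 0.

Definition sform (u w : 'cV[F]_(n + n)) : F := (u^T *m witt_gram *m w) 0 0.

(* Sp_2n(F), acting on column vectors from the left. *)
Definition Sp (g : 'M[F]_(n + n)) : Prop :=
  g^T *m witt_gram *m g = witt_gram.

(* diag(t_1, .., t_n, t_n^-1, .., t_1^-1) *)
Definition torus_elt (t : 'rV[F]_n) : 'M[F]_(n + n) :=
  diag_mx (row_mx t (\row_i (t 0 (rev_ord i))^-1)).

(* omega_(i+1) = epsilon_1 + .. + epsilon_(i+1), as a character. *)
Definition fundamental_weight (i : 'I_n) (t : 'rV[F]_n) : F :=
  \prod_(j < n | (j <= i)%N) t 0 j.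

Definition weight (a : 'I_n -> nat) (t : 'rV[F]_n) : F :=
  \prod_(i < n) fundamental_weight i t ^+ a i.

(* The unipotent radical of the Borel subgroup of upper triangular matrices of
   Sp; its roots are epsilon_i - epsilon_j (i < j), epsilon_i + epsilon_j and
   2 epsilon_i, the positive roots belonging to the fundamental weights above. *)
Definition Sp_unipotent (u : 'M[F]_(n + n)) : Prop :=
  Sp u /\ forall i j : 'I_(n + n), (j <= i)%N -> u i j = (i == j)%:R.

Record orthogonal_decomposition (k : nat) (ns : 'I_k -> nat)
    (U : 'I_k -> {vspace 'cV[F]_(n + n)}) : Prop := {
  od_dim : forall i, \dim (U i) = (2 * ns i)%N;
  od_span : (\sum_(i < k) U i)%VS = fullv;
  od_direct : directv (\sum_(i < k) U i);
  od_orthogonal : forall i j, i != j ->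
    forall u w, u \in U i -> w \in U j -> sform u w = 0;
  od_nondegenerate : forall i u, u \in U i ->
    (forall w, w \in U i -> sform u w = 0) -> u = 0 }.

(* H_i = Sp(U_i), extended by the identity on the other summands. *)
Definition Sp_factor (k : nat) (U : 'I_k -> {vspace 'cV[F]_(n + n)})
    (i : 'I_k) (g : 'M[F]_(n + n)) : Prop :=
  [/\ Sp g,
      forall u, u \in U i -> g *m u \in U i
    & forall j, j != i -> forall u, u \in U j -> g *m u = u].

Definition Sp_product (k : nat) (U : 'I_k -> {vspace 'cV[F]_(n + n)})
    (g : 'M[F]_(n + n)) : Prop :=
  exists2 h : 'I_k -> 'M[F]_(n + n),
    forall i, Sp_factor U i (h i) & g = \prod_(i < k) h i.

Section Representation.
Variables (d : nat) (rho : 'M[F]_(n + n) -> 'M[F]_d).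

(* Only the values of rho on Sp matter. As Sp is Zariski closed in the space of
   matrices, its regular functions are the restrictions of polynomials in the
   matrix entries. *)
Record rational_representation : Prop := {
  rr_one : rho 1%:M = 1%:M;
  rr_mul : forall g h, Sp g -> Sp h -> rho (g *m h) = rho g *m rho h;
  rr_regular : forall i j : 'I_d,
    exists P : {mpoly F[(n + n) * (n + n)]},
      forall g, Sp g -> rho g i j = P.@[fun l => mxvec g 0 l] }.

Definition stable (K : 'M[F]_(n + n) -> Prop) (W : {vspace 'cV[F]_d}) : Prop :=
  forall g, K g -> forall v, v \in W -> rho g *m v \in W.

Definition simple_quotient (K : 'M[F]_(n + n) -> Prop)
    (W' W : {vspace 'cV[F]_d}) : Prop :=
  [/\ (W' <= W)%VS, W' != W
    & forall X : {vspace 'cV[F]_d},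
        stable K X -> (W' <= X)%VS -> (X <= W)%VS -> X = W' \/ X = W].

Definition irreducible_representation : Prop :=
  (0 < d)%N /\
  forall W : {vspace 'cV[F]_d}, stable Sp W -> W = 0%VS \/ W = fullv.

Definition has_highest_weight (a : 'I_n -> nat) : Prop :=
  exists v : 'cV[F]_d,
    [/\ v != 0,
        forall u, Sp_unipotent u -> rho u *m v = v
      & forall t : 'rV[F]_n, (forall i, t 0 i != 0) ->
          rho (torus_elt t) *m v = weight a t *: v].

Record composition_series (K : 'M[F]_(n + n) -> Prop) (m : nat)
    (c : nat -> {vspace 'cV[F]_d}) : Prop := {
  cs_bottom : c 0%N = 0%VS;
  cs_top : c m = fullv;
  cs_stable : forall j, (j <= m)%N -> stable K (c j);
  cs_simple : forall j, (j < m)%N -> simple_quotient K (c j) (c j.+1) }.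

Definition composition_factor (K : 'M[F]_(n + n) -> Prop)
    (W' W : {vspace 'cV[F]_d}) : Prop :=
  exists m c j,
    [/\ composition_series K m c, (j < m)%N, W' = c j & W = c j.+1].

Definition acts_trivially (K : 'M[F]_(n + n) -> Prop)
    (W' W : {vspace 'cV[F]_d}) : Prop :=
  forall g, K g -> forall v, v \in W -> rho g *m v - v \in W'.

End Representation.
End Symplectic.

Definition p_restricted (p n : nat) (a : 'I_n -> nat) : Prop :=
  (0 < p)%N -> forall i, (a i < p)%N.

(* Main.v *)
(* Write [P g = \prod_i Delta_i(g)^(a_i)], where [Delta_i] is the leading principal
   minor of size [i] of the matrix [g]; it is homogeneous of degree
   [D = \sum_i i a_i].  If [v] is a highest weight vector and [f] a linear form fixed
   by the opposite unipotent radical, then [f (rho g v) = P g * f v] on the big cell,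
   hence on all of [Sp], and [f v <> 0] by irreducibility.

   For [h_i] in [H_i] one has [(h_i - 1) (h_j - 1) = 0] when [i != j], so that
   [f (rho g (\prod_i (rho h_i - 1)) (rho g' v))] is, up to the factor [f v], the
   iterated difference of the polynomial [P] at [g g'] along the [k] directions
   [g (h_i - 1) g'].  If [D < k] this vanishes for reasons of degree, so
   [\prod_i (rho h_i - 1) = 0], and a composition factor on which every [H_i] acts
   nontrivially cannot exist.

   Conversely assume (1), and let [h_i] be a torsion element of a rank one torus of
   [H_i].  Then [\prod_i (rho h_i - 1)] is nilpotent, because it is 0 on each
   composition factor, and semisimple, hence 0.  By density of the torsion elements,
   all [k]-fold differences of [P] at 0 along rank one matrices vanish (the
   differences may be taken inside the Levi subgroup [GL_n], and then for all pairs
   of [n x n] matrices by density again), and so do all [N]-fold ones for [N >= k].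
   But when [a_i < p] the [D]-fold difference of [P] along suitable elementary
   matrices is, up to sign, a product of factorials of the [a_i]; so [D < k]. *)

Require Import Defs.
From HB Require Import structures.
From mathcomp Require Import all_boot all_order all_algebra.
From mathcomp Require Import mpoly.
From mathcomp Require Import all_field perm ring.
From Stdlib Require Import Classical.

Set Implicit Arguments.
Unset Strict Implicit.
Unset Printing Implicit Defensive.

Import GRing.Theory.
Local Open Scope ring_scope.

(** * Iterated differences *)

Section IteratedDifferences.

Variables (V W : zmodType).
Implicit Types (l : seq V) (f g : V -> W) (x d : V).

(** Finite differences rather than derivatives: products of operators [rho h - 1] produce them, and
    they behave well in every characteristic. *)
Fixpoint nabla l f x : W :=
  if l is d :: l' then nabla l' f (x + d) - nabla l' f x else f x.

Lemma eq_nabla l f g x : f =1 g -> nabla l f x = nabla l g x.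
Proof. by move=> fg; elim: l x => [|d l IH] x /=; rewrite ?IH ?fg. Qed.

Lemma nabla_cat l1 l2 f x : nabla (l1 ++ l2) f x = nabla l1 (nabla l2 f) x.
Proof. by elim: l1 x => [|d l1 IH] x //=; rewrite !IH. Qed.

(** Differences commute, so the first one may be moved inside and applied to the function. *)
Lemma nabla_cons d l f x :
  nabla (d :: l) f x = nabla l (fun y => f (y + d) - f y) x.
Proof.
elim: l d x => [|e l IH] d x //; rewrite [RHS]/= -!IH /= (addrAC x e d).
by rewrite !opprB addrACA [RHS]addrACA (addrC (- nabla l f (x + d))).
Qed.

Lemma nabla_translate l f x c : nabla l (fun y => f (y + c)) x = nabla l f (x + c).
Proof. by elim: l x => [|d l IH] x //=; rewrite !IH addrAC. Qed.

Lemma nablaB l f g x :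
  nabla l (fun y => f y - g y) x = nabla l f x - nabla l g x.
Proof.
by elim: l x => [|d l IH] x //=; rewrite !IH !opprB addrACA [RHS]addrACA
  [- _ + _ in LHS]addrC.
Qed.

Lemma nablaD l f g x :
  nabla l (fun y => f y + g y) x = nabla l f x + nabla l g x.
Proof. by elim: l x => [|d l IH] x //=; rewrite !IH opprD addrACA. Qed.

Lemma nabla0 l x : nabla l (fun=> 0) x = 0.
Proof. by elim: l x => [|d l IH] x //=; rewrite !IH subrr. Qed.

Lemma nabla_sum (I : Type) (r : seq I) (Q : pred I) (f : I -> V -> W) l x :
  nabla l (fun y => \sum_(i <- r | Q i) f i y) x
    = \sum_(i <- r | Q i) nabla l (f i) x.
Proof.
elim: r => [|i r IH].
  by rewrite big_nil -[RHS](nabla0 l x); apply: eq_nabla => y; rewrite big_nil.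
rewrite big_cons -IH; case: ifP => Qi; last first.
  by apply: eq_nabla => y; rewrite big_cons Qi.
by rewrite -nablaD; apply: eq_nabla => y; rewrite big_cons Qi.
Qed.

Lemma perm_nabla l1 l2 f x : perm_eq l1 l2 -> nabla l1 f x = nabla l2 f x.
Proof.
elim: l1 l2 f x => [|d l1 IH] l2 f x.
  by rewrite perm_sym => /perm_nilP ->.
move=> E; have dl2 : d \in l2 by rewrite -(perm_mem E) mem_head.
have -> : nabla l2 f x = nabla (d :: rem d l2) f x.
  elim: l2 {E} f x dl2 => [|e l2 IH2] f x //=; rewrite inE eq_sym.
  by case: eqP => [->|_] //= dl2; rewrite !IH2 //= (addrAC x d e) !opprB addrACA
    [RHS]addrACA (addrC (- nabla (rem d l2) f (x + e))).
rewrite !nabla_cons; apply: IH.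
by rewrite -(perm_cons d) (permPl E) perm_to_rem.
Qed.

End IteratedDifferences.

Lemma nabla_comp (V1 V2 W : zmodType) (u : V1 -> V2) (f : V2 -> W) l x :
  {morph u : y z / y + z} -> nabla l (fun y => f (u y)) x = nabla (map u l) f (u x).
Proof. by move=> uD; elim: l x => [|d l IH] x //=; rewrite !IH uD. Qed.

Lemma nablaZ (V : zmodType) (R : pzRingType) (c : R) (f : V -> R) l x :
  nabla l (fun y => c * f y) x = c * nabla l f x.
Proof. by elim: l x => [|d l IH] x //=; rewrite !IH mulrBr. Qed.

(** Traversing a step from its other end changes the sign of the difference, once for each
    direction. *)
Lemma nabla_opp (V : zmodType) (R : pzRingType) (f : V -> R) l x :
  nabla (map -%R l) f (x + \sum_(d <- l) d) = (-1) ^+ size l * nabla l f x.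
Proof.
elim: l x => [|d l IH] x /=; first by rewrite big_nil addr0 mul1r.
rewrite big_cons (addrCA x d) [d + _]addrC addrK addrAC !IH.
by rewrite exprS mulN1r mulNr mulrBr opprB.
Qed.

(** * Functions of bounded degree *)

Section LowDegree.

Variables (V : zmodType) (R : comPzRingType).
Implicit Types (f : V -> R).

(** Frechet's coordinate-free notion of a polynomial function; [degree_lt 0 f] means that [f] is
    zero. *)
Definition degree_lt (d : nat) f : Prop :=
  forall l x, (d <= size l)%N -> nabla l f x = 0.

Lemma degree_lt_ext d f g : f =1 g -> degree_lt d f -> degree_lt d g.
Proof. by move=> fg df l x /df; rewrite -(eq_nabla _ _ fg). Qed.

Lemma degree_lt_delta d f c :
  degree_lt d.+1 f -> degree_lt d (fun y => f (y + c) - f y).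
Proof. by move=> df l x dl; rewrite -nabla_cons df. Qed.

Lemma degree_lt_translate d f c :
  degree_lt d f -> degree_lt d (fun y => f (y + c)).
Proof. by move=> df l x dl; rewrite nabla_translate df. Qed.

Lemma degree_ltD d f g :
  degree_lt d f -> degree_lt d g -> degree_lt d (fun y => f y + g y).
Proof. by move=> df dg l x dl; rewrite nablaD df ?dg ?addr0. Qed.

Lemma degree_ltZ d c f : degree_lt d f -> degree_lt d (fun y => c * f y).
Proof. by move=> df l x dl; rewrite nablaZ df ?mulr0. Qed.

(** Leibniz rule: the difference of [q * f] along [e] is [q] times the difference of [f], plus [q e]
    times a translate of [f]. *)
Lemma degree_lt_mulX d (q : V -> R) f : {morph q : y z / y + z} ->
  degree_lt d f -> degree_lt d.+1 (fun y => q y * f y).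
Proof.
move=> qD; elim: d f => [|d IH] f df [|e l] x // dl.
  rewrite (@eq_nabla _ _ _ _ (fun=> 0)) ?nabla0 // => y.
  by rewrite (_ : f y = 0) ?mulr0 //; exact: (df [::]).
rewrite nabla_cons.
rewrite (@eq_nabla _ _ _ _ (fun y => q y * (f (y + e) - f y) + q e * f (y + e))).
  apply: degree_ltD (dl : (d.+1 <= size l)%N); first exact: IH (degree_lt_delta _ df).
  exact/degree_ltZ/degree_lt_translate.
by move=> y; rewrite qD mulrDl mulrBr addrAC.
Qed.

End LowDegree.

(** * Products of leading minors *)

Section Words.

Variables (F : fieldType) (n : nat).
Implicit Types (w v : seq ('I_n * 'I_n)) (M : 'M[F]_n) (f : 'M[F]_n -> F).

(** A monomial in the matrix entries, given as the list of its variables with repetition. *)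
Definition word w M : F := \prod_(q <- w) M q.1 q.2.

Lemma word_cons q w M : word (q :: w) M = M q.1 q.2 * word w M.
Proof. exact: big_cons. Qed.

Lemma word_cat w v M : word (w ++ v) M = word w M * word v M.
Proof. exact: big_cat. Qed.

Lemma entryD (i j : 'I_n) : {morph (fun M : 'M[F]_n => M i j) : M N / M + N}.
Proof. by move=> M N; rewrite mxE. Qed.

Lemma degree_lt_word w : degree_lt (size w).+1 (word w).
Proof.
elim: w => [|q w IH].
  apply: (@degree_lt_ext _ _ _ (fun=> 1)) => [M|[|d l] x // _].
    by rewrite /word big_nil.
  by rewrite nabla_cons (@eq_nabla _ _ _ _ (fun=> 0)) ?nabla0 // => y; rewrite subrr.
apply: (@degree_lt_ext _ _ _ (fun M => M q.1 q.2 * word w M)).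
  by move=> M; rewrite word_cons.
exact/degree_lt_mulX/IH/entryD.
Qed.

Definition homogeneous N f : Prop :=
  exists2 s : seq (F * seq ('I_n * 'I_n)),
    all (fun c => size c.2 == N) s & forall M, f M = \sum_(c <- s) c.1 * word c.2 M.

Lemma homogeneous_ext N f g : f =1 g -> homogeneous N f -> homogeneous N g.
Proof. by move=> fg [s sN fE]; exists s => // M; rewrite -fg. Qed.

Lemma homogeneous_word w : homogeneous (size w) (word w).
Proof. by exists [:: (1, w)] => [|M] /=; rewrite ?eqxx // big_seq1 mul1r. Qed.

Lemma homogeneous0 N : homogeneous N (fun=> 0).
Proof. by exists [::] => // M; rewrite big_nil. Qed.

Lemma homogeneousD N f g :
  homogeneous N f -> homogeneous N g -> homogeneous N (fun M => f M + g M).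
Proof.
move=> [s sN fE] [t tN gE]; exists (s ++ t); first by rewrite all_cat sN.
by move=> M; rewrite big_cat fE gE.
Qed.

Lemma homogeneousZ N c f : homogeneous N f -> homogeneous N (fun M => c * f M).
Proof.
move=> [s sN fE]; exists [seq (c * x.1, x.2) | x <- s]; first by rewrite all_map.
by move=> M; rewrite fE mulr_sumr big_map; apply: eq_bigr => x _; rewrite mulrA.
Qed.

Lemma homogeneous_sum (I : Type) (r : seq I) N (f : I -> 'M[F]_n -> F) :
  (forall i, homogeneous N (f i)) -> homogeneous N (fun M => \sum_(i <- r) f i M).
Proof.
move=> fN; elim: r => [|i r IH].
  by apply: homogeneous_ext (homogeneous0 N) => M; rewrite big_nil.
by apply: homogeneous_ext (homogeneousD (fN i) IH) => M; rewrite big_cons.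
Qed.

Lemma homogeneousM N N' f g : homogeneous N f -> homogeneous N' g ->
  homogeneous (N + N') (fun M => f M * g M).
Proof.
move=> [s sN fE] [t tN gE].
exists [seq (x.1 * y.1, x.2 ++ y.2) | x <- s, y <- t].
  apply/allP => _ /allpairsP[[x y] /= [/(allP sN)/eqP xN /(allP tN)/eqP yN ->]].
  by rewrite size_cat xN yN.
move=> M; rewrite fE gE big_allpairs_dep mulr_suml; apply: eq_bigr => x _.
by rewrite mulr_sumr; apply: eq_bigr => y _; rewrite word_cat mulrACA.
Qed.

Lemma homogeneous_prod (I : Type) (r : seq I) (N : I -> nat) (f : I -> 'M[F]_n -> F) :
  (forall i, homogeneous (N i) (f i)) ->
  homogeneous (\sum_(i <- r) N i) (fun M => \prod_(i <- r) f i M).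
Proof.
move=> fN; elim: r => [|i r IH].
  rewrite big_nil; apply: homogeneous_ext (homogeneous_word [::]) => M.
  by rewrite /word !big_nil.
by rewrite big_cons; apply: homogeneous_ext (homogeneousM (fN i) IH) => M; rewrite big_cons.
Qed.

Lemma homogeneous_degree_lt N f : homogeneous N f -> degree_lt N.+1 f.
Proof.
move=> [s /allP sN fE] l x Nl; rewrite (eq_nabla _ _ fE) nabla_sum big1_seq //= => c cs.
by rewrite nablaZ degree_lt_word ?mulr0 // (eqP (sN _ cs)).
Qed.

Definition unit_mx (q : 'I_n * 'I_n) : 'M[F]_n := delta_mx q.1 q.2.

Lemma unit_mxE q p : unit_mx q p.1 p.2 = (p == q)%:R.
Proof. by rewrite mxE -pair_eqE. Qed.

(** To leading order, a difference along a matrix unit acts on a monomial as the partial derivative;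
    the error loses at least two degrees. Induction on the word by the Leibniz rule. *)
Lemma degree_lt_delta_word q w :
  degree_lt (size w).-1
    (fun M => word w (M + unit_mx q) - word w M
              - (count_mem q w)%:R * word (rem q w) M).
Proof.
elim: w => [|p w IH] /=.
  move=> l x _; rewrite (@eq_nabla _ _ _ _ (fun=> 0)) ?nabla0 // => M.
  by rewrite /word !big_nil subrr mul0r subr0.
have dw : degree_lt (size w) (fun M => word w (M + unit_mx q) - word w M).
  exact/degree_lt_delta/degree_lt_word.
have low : degree_lt (size w)
    (fun M => M p.1 p.2 * (word w (M + unit_mx q) - word w M
                           - (count_mem q w)%:R * word (rem q w) M)).
  (* For the empty word the bound [(size w).-1] is truncated to 0, but the expression itself is
     zero. *)
  case: (w) IH => [|p' w'] IH; last exact/degree_lt_mulX/IH/entryD.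
  move=> l x _; rewrite (@eq_nabla _ _ _ _ (fun=> 0)) ?nabla0 // => M.
  by rewrite /word !big_nil subrr mul0r subr0 mulr0.
case: (eqVneq p q) => [pq|pq] /=; last first.
  apply: degree_lt_ext low => M; rewrite !word_cons mxE unit_mxE (negPf pq) addr0.
  by rewrite add0n !mulrBr mulrCA.
apply: degree_lt_ext (degree_ltD low dw) => M.
have -> : M p.1 p.2 * (word w (M + unit_mx q) - word w M
                       - (count_mem q w)%:R * word (rem q w) M)
        = M p.1 p.2 * (word w (M + unit_mx q) - word w M)
          - (count_mem q w)%:R * word w M.
  rewrite mulrBr; congr (_ - _); rewrite mulrCA.
  have [qw|qw] := boolP (q \in w); last by rewrite (count_memPn qw) !mul0r.
  by rewrite pq -word_cons /word -(perm_big _ (perm_to_rem qw)).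
rewrite !word_cons mxE unit_mxE pq eqxx mulrDl mul1r natrD mulrDl mul1r mulrBr.
by ring.
Qed.

(** In top degree the lower order errors disappear: the difference is the product of the factorials
    of the multiplicities in [v] when [v] is a rearrangement of [w], and 0 otherwise. *)
Lemma nabla_word v w M : (forall q, ((count_mem q v)`!)%:R != 0 :> F) ->
  size v = size w -> (nabla (map unit_mx v) (word w) M == 0) = ~~ perm_eq v w.
Proof.
elim: v w => [|q v IH] w /= vF vw.
  have -> : w = [::] by apply: size0nil.
  by rewrite /word big_nil perm_refl oner_eq0.
rewrite -/(nabla (_ :: _) _ _) nabla_cons.
rewrite (_ : nabla _ _ _ = (count_mem q w)%:R
                           * nabla (map unit_mx v) (word (rem q w)) M); last first.
  apply/eqP; rewrite -subr_eq0 -nablaZ -nablaB; apply/eqP.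
  by apply: degree_lt_delta_word; rewrite size_map -vw.
have [qw|qw] := boolP (q \in w); last first.
  rewrite (count_memPn qw) mul0r eqxx; apply/esym; apply: contra qw.
  by move=> /perm_mem <-; rewrite mem_head.
have pE : perm_eq (q :: v) w = perm_eq v (rem q w).
  by rewrite (permPr (perm_to_rem qw)) perm_cons.
rewrite mulf_eq0 IH; first last.
- by rewrite size_rem // -vw.
- move=> p; apply: contraNneq (vF p) => p0.
  by case: (_ == p); rewrite ?add0n ?p0 // factS natrM p0 mulr0.
rewrite pE; have [vp|] := boolP (perm_eq v (rem q w)); last by rewrite orbT.
rewrite orbF; apply/negP => /eqP c0; have := vF q.
rewrite eqxx add1n factS natrM.
have -> : (count_mem q v).+1 = count_mem q w.
  by rewrite -(seq.permP (etrans pE vp)) /= eqxx.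
by rewrite c0 mul0r eqxx.
Qed.

Definition lead_minor (i : 'I_n) M : F :=
  \det (mxsub (widen_ord (ltn_ord i)) (widen_ord (ltn_ord i)) M).

Definition permutation_word (i : 'I_n) (s : 'S_i.+1) : seq ('I_n * 'I_n) :=
  [seq (widen_ord (ltn_ord i) r, widen_ord (ltn_ord i) (s r)) | r <- enum 'I_i.+1].

Lemma lead_minorE i M :
  lead_minor i M = \sum_(s : 'S_i.+1) (-1) ^+ s * word (permutation_word s) M.
Proof.
apply: eq_bigr => s _; congr (_ * _); rewrite /word big_map big_enum /=.
by apply: eq_bigr => r _; rewrite mxE.
Qed.

Lemma homogeneous_lead_minor (i : 'I_n) : homogeneous i.+1 (lead_minor i).
Proof.
apply: homogeneous_ext (fun M => esym (lead_minorE i M)) _ => /=.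
apply: homogeneous_sum => s; apply: homogeneousZ.
have -> : i.+1 = size (permutation_word s) by rewrite size_map size_enum_ord.
exact: homogeneous_word.
Qed.

(** The reversal picks the entries with [q.1 + q.2 = i], so that minors of different sizes receive
    disjoint sets of variables. *)
Definition antidiagonal (i : 'I_n) := permutation_word (perm (@rev_ord_inj i.+1)).

Definition antidiagonals (L : seq 'I_n) := flatten (map antidiagonal L).

Lemma count_antidiagonal i q :
  count_mem q (antidiagonal i) = ((q.1 + q.2)%N == i) :> nat.
Proof.
rewrite /antidiagonal /permutation_word count_uniq_mem; last first.
  rewrite map_inj_uniq ?enum_uniq // => r r' [/eqP rr' _].
  exact/val_inj/eqP.
congr (nat_of_bool _); apply/mapP/eqP => [[r _ ->] /=|qi].
  by rewrite permE /= subSS subnKC // -ltnS.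
have q1 : (q.1 < i.+1)%N by rewrite ltnS -qi leq_addr.
exists (Ordinal q1); first by rewrite mem_enum.
rewrite [LHS]surjective_pairing; congr (_, _); apply: val_inj => //=.
by rewrite permE /= subSS -qi addKn.
Qed.

Lemma count_antidiagonals L q :
  count_mem q (antidiagonals L) = count (fun i : 'I_n => (q.1 + q.2)%N == i) L.
Proof.
by elim: L => //= i L IH; rewrite count_cat IH count_antidiagonal.
Qed.

(** Otherwise [s r <= rev_ord r] for all [r]; both sides have the same sum, which forces equality
    everywhere. *)
Lemma permutation_word_high (i : 'I_n) (s : 'S_i.+1) : s != perm (@rev_ord_inj i.+1) ->
  exists2 q, q \in permutation_word s & (i < q.1 + q.2)%N.
Proof.
move=> sN; have [r ir|no] := pickP [pred r : 'I_i.+1 | (i < r + s r)%N].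
  exists (widen_ord (ltn_ord i) r, widen_ord (ltn_ord i) (s r)) => //.
  by apply: map_f; rewrite mem_enum.
case/eqP: sN; apply/permP => r; rewrite permE; apply/val_inj => /=.
have le r' : (s r' <= rev_ord r')%N.
  by have /negbT := no r'; rewrite -leqNgt /= subSS leq_subRL // -ltnS.
have eqs : (\sum_(r : 'I_i.+1) s r = \sum_(r : 'I_i.+1) rev_ord r)%N.
  transitivity (\sum_(r : 'I_i.+1) r)%N.
    by rewrite [RHS](reindex_inj (@perm_inj _ s)).
  by rewrite [LHS](reindex_inj rev_ord_inj).
move: eqs => /eqP; rewrite (leqif_sum (fun r' _ => leqif_eq (le r'))).
by move=> /forallP /(_ r) /eqP.
Qed.

(** Each monomial of the product contains [q] more often than [v] does, so none is a rearrangement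
    of [v]. *)
Lemma nabla_word_homogeneous0 v w N f M q :
  (forall q, ((count_mem q v)`!)%:R != 0 :> F) -> homogeneous N f ->
  size v = (size w + N)%N -> (count_mem q v < count_mem q w)%N ->
  nabla (map unit_mx v) (fun M => word w M * f M) M = 0.
Proof.
move=> vF [s /allP sN fE] vw qv.
rewrite (@eq_nabla _ _ _ _ (fun M => \sum_(c <- s) c.1 * word (w ++ c.2) M)).
  rewrite nabla_sum big1_seq // => c /= cs; rewrite nablaZ.
  apply/eqP; rewrite mulf_eq0 nabla_word ?size_cat ?(eqP (sN _ cs)) //.
  apply/orP; right; apply: contraL qv => /seq.permP ->.
  by rewrite count_cat -leqNgt leq_addr.
by move=> y; rewrite fE mulr_sumr; apply: eq_bigr => c _; rewrite word_cat mulrCA.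
Qed.

(** The minors are expanded one at a time, the largest first, and [w] collects the antidiagonals
    already chosen. Any other permutation brings in a variable beyond the current antidiagonal; the
    antidiagonals of the remaining minors, which are no larger, do not contain it, so that this term
    does not contribute. *)
Lemma nabla_minors_neq0 (L : seq 'I_n) w M :
  sorted (fun i j : 'I_n => (j <= i)%N) L ->
  (forall q, ((count_mem q (w ++ antidiagonals L))`!)%:R != 0 :> F) ->
  nabla (map unit_mx (w ++ antidiagonals L))
    (fun M => word w M * \prod_(i <- L) lead_minor i M) M != 0.
Proof.
elim: L w => [|i L IH] w.
  rewrite cats0 => _ wF.
  rewrite (@eq_nabla _ _ _ _ (word w)) ?nabla_word ?perm_refl //.
  by move=> y; rewrite big_nil mulr1.
move=> srt; set v := w ++ _ => vF.
pose f M := \prod_(i <- L) lead_minor i M.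
have fH : homogeneous (\sum_(i <- L) i.+1) f.
  by apply: homogeneous_prod; apply: homogeneous_lead_minor.
have Li j : j \in L -> (j <= i)%N.
  move: srt => /= /order_path_min /allP le; apply: le.
  by move=> a b c ab bc; apply: leq_trans bc ab.
have sizeL : size (antidiagonals L) = (\sum_(i <- L) i.+1)%N.
  rewrite size_flatten /shape -map_comp sumnE big_map.
  by apply: eq_bigr => j _; rewrite /= size_map size_enum_ord.
have vE : v = (w ++ antidiagonal i) ++ antidiagonals L by rewrite -catA.
rewrite (@eq_nabla _ _ _ _ (fun M => \sum_(s : 'S_i.+1)
   (-1) ^+ s * (word (w ++ permutation_word s) M * f M))); last first.
  move=> y; rewrite big_cons lead_minorE mulr_suml mulr_sumr.
  by apply: eq_bigr => s _; rewrite word_cat -!mulrA mulrCA.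
rewrite nabla_sum (bigD1 (perm (@rev_ord_inj i.+1))) //= big1 => [|s sN]; last first.
  have [q qs iq] := permutation_word_high sN.
  rewrite nablaZ (@nabla_word_homogeneous0 _ _ _ _ _ q vF fH) ?mulr0 //.
    by rewrite vE !size_cat !size_map -sizeL.
  rewrite vE !count_cat count_antidiagonal count_antidiagonals.
  rewrite (gtn_eqF iq) addn0 (_ : count _ L = 0%N).
    by rewrite addn0 -addn1 leq_add2l -has_count has_pred1.
  apply/eqP; rewrite -leqn0 leqNgt -has_count; apply/hasPn => j /Li ji.
  by rewrite (gtn_eqF (leq_ltn_trans ji iq)).
rewrite addr0 nablaZ mulf_neq0 ?signr_eq0 // vE; apply: IH; last by rewrite -vE.
exact: path_sorted srt.
Qed.

Definition highest_weight_poly (a : 'I_n -> nat) M : F :=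
  \prod_i lead_minor i M ^+ a i.

Lemma homogeneous_highest_weight_poly (a : 'I_n -> nat) :
  homogeneous (\sum_i a i * i.+1) (highest_weight_poly a).
Proof.
apply: homogeneous_prod => i.
have := @homogeneous_prod _ (nseq (a i) i) (fun=> i.+1) _
  (fun=> homogeneous_lead_minor i).
have -> : (\sum_(j <- nseq (a i) i) i.+1 = a i * i.+1)%N.
  by rewrite big_const_seq count_predT size_nseq iter_addn_0 mulnC.
apply: homogeneous_ext => M.
by rewrite big_const_seq count_predT size_nseq -Monoid.iteropE.
Qed.

(* James's computation: the antidiagonal term of each minor carries its own set
   of variables, each with exponent [a i], hence the factor [(a i)`!]. *)
Lemma nabla_highest_weight_poly (a : 'I_n -> nat) :
  (forall i, ((a i)`!)%:R != 0 :> F) ->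
  exists2 v : seq ('I_n * 'I_n), size v = (\sum_i a i * i.+1)%N
    & nabla (map unit_mx v) (highest_weight_poly a) 0 != 0.
Proof.
move=> aF.
(* Each index [i] is listed [a i] times, then sorted with the largest first. *)
pose L0 := flatten [seq nseq (a i) i | i <- enum 'I_n].
pose L := sort (fun i j : 'I_n => (j <= i)%N) L0.
have LL0 : perm_eq L L0 by rewrite perm_sort.
have cL (P : pred 'I_n) : count P L = (\sum_(i | P i) a i)%N.
  rewrite (seq.permP LL0) count_flatten -map_comp sumnE big_map big_enum /=.
  rewrite [RHS]big_mkcond; apply: eq_bigr => i _.
  by rewrite count_nseq; case: (P i); rewrite ?mul1n.
have bL (T : Type) (idx : T) (op : Monoid.com_law idx) (G : 'I_n -> T) :
    \big[op/idx]_(i <- L) G i = \big[op/idx]_i iterop (a i) op (G i) idx.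
  rewrite (perm_big _ LL0) big_flatten big_map big_enum /=.
  by apply: eq_bigr => i _; rewrite big_nseq Monoid.iteropE.
exists (antidiagonals L).
  rewrite size_flatten /shape -map_comp sumnE big_map bL.
  by apply: eq_bigr => i _; rewrite /= size_map size_enum_ord Monoid.iteropE
    iter_addn_0 mulnC.
have := @nabla_minors_neq0 L [::] 0 _ _.
rewrite cat0s (@eq_nabla _ _ _ _ (highest_weight_poly a)) => [|y].
  apply=> [|q]; first by apply: sort_sorted => i j; apply: leq_total.
  rewrite count_antidiagonals cL.
  (* The multiplicity of [q] is [a (q.1 + q.2)] when this index is below [n], and 0 otherwise. *)
  have [lt|ge] := ltnP (q.1 + q.2) n.
    by rewrite (big_pred1 (Ordinal lt)) // => i; rewrite eq_sym.
  rewrite big_pred0 ?oner_eq0 // => i; rewrite gtn_eqF //.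
  exact: leq_trans (ltn_ord i) ge.
by rewrite /word big_nil mul1r bL.
Qed.

End Words.

(** * Differences along rank one matrices *)

Section RankOneDifferences.

Variables (F : fieldType) (n : nat).
Implicit Types (p : 'cV[F]_n * 'rV[F]_n) (f : 'M[F]_n -> F).

Definition rank_one p : 'M[F]_n := p.1 *m p.2.

(** For a fixed column, [rank_one] is additive in the row. A step along [(u, w)] from the base point
    [rank_one (u, z)] is therefore the difference of the steps along [(u, z + w)] and [(u, z)] from
    0, and base points are removed one column at a time. *)
Lemma nabla_rank_one_translate (us : seq 'cV[F]_n) f :
  (forall ws, size ws = size us -> nabla (map rank_one (zip us ws)) f 0 = 0) ->
  forall ws zs, size ws = size us -> size zs = size us ->
  nabla (map rank_one (zip us ws)) f (\sum_(p <- zip us zs) rank_one p) = 0.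
Proof.
elim: us f => [|u us IH] f f0 [|w ws] [|z zs] //.
  by rewrite big_nil => _ _; apply: (f0 [::]).
move=> [ws_us] [zs_us]; rewrite [zip _ (z :: _)]/= big_cons [X in nabla X]/=.
set x := \sum_(p <- _) _.
pose g y := f (y + rank_one (u, w)) - f y.
rewrite nabla_cons addrC -(nabla_translate _ g); apply: IH => // ys ys_us.
rewrite (nabla_translate _ g) add0r -nabla_cons /=.
have d0 y : nabla (map rank_one (zip us ys)) f (rank_one (u, y))
            = nabla (map rank_one (zip us ys)) f 0.
  apply/eqP; rewrite -subr_eq0; have /= := f0 (y :: ys).
  by rewrite add0r ys_us => ->.
by rewrite (_ : _ + _ = rank_one (u, z + w)) ?d0 ?subrr // /rank_one mulmxDr.
Qed.

(** The coefficients of [u] on the vectors [us] are absorbed into the rows. *)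
Lemma rank_one_span (us : seq 'cV[F]_n) u w : u \in <<us>>%VS ->
  exists2 zs, size zs = size us
    & rank_one (u, w) = \sum_(p <- zip us zs) rank_one p.
Proof.
elim: us u => [|v us IH] u.
  rewrite span_nil memv0 => /eqP ->; exists [::] => //.
  by rewrite big_nil /rank_one mul0mx.
rewrite span_cons => /memv_addP[_ /vlineP[c ->] [u' /IH[zs szs uE] ->]].
exists (c *: w :: zs); rewrite /= ?szs // big_cons -uE /rank_one /=.
by rewrite mulmxDl -scalemxAl scalemxAr.
Qed.

(* More than [n] rank-one directions have dependent column vectors, and eliminating
   one of these columns leaves a difference along one direction less. *)
Lemma nabla_rank_one0 f (k : nat) : (k <= n)%N ->
  (forall L1 L2, size L1 = k -> (size L1 + size L2 <= n)%N ->
    nabla (map rank_one L1) f (\sum_(p <- L2) rank_one p) = 0) ->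
  forall L, (k <= size L)%N -> nabla (map rank_one L) f 0 = 0.
Proof.
move=> kn f0.
(* With at most [n] directions, [k] of them are kept as differences and the others are expanded into
   shifts of the base point. *)
have low L : (k <= size L <= n)%N -> nabla (map rank_one L) f 0 = 0.
  move=> /andP[kL Ln]; rewrite -(cat_take_drop k L) map_cat.
  have tk : size (take k L) = k by rewrite size_takel.
  rewrite (perm_nabla _ _ (permEl (perm_catC _ _))) nabla_cat.
  have -> : 0 = \sum_(p <- [::]) rank_one p :> 'M[F]_n by rewrite big_nil.
  have : (k + (size (drop k L) + size (Nil ('cV[F]_n * 'rV[F]_n))) <= n)%N.
    by rewrite addn0 size_drop subnKC.
  elim: (drop k L) [::] => [|p L' IH] L2 /= L2n.
    by apply: f0; rewrite tk.
  rewrite (_ : _ + rank_one p = \sum_(q <- p :: L2) rank_one q); last first.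
    by rewrite big_cons addrC.
  rewrite !IH ?subrr //; last by rewrite /= addnS -addSn.
  by apply: leq_trans L2n; rewrite leq_add2l leq_add2r.
move=> L; have [Ln kL|] := leqP (size L) n; first by rewrite low ?kL.
move=> nL _; move: {1}(size L) (erefl (size L)) => m mL.
have [e me] : exists e, m = (n + e)%N by exists (m - n)%N; rewrite mL subnKC // ltnW.
elim: e m me L {nL} mL => [|e IH] m me L mL.
  by apply: low; rewrite -mL me addn0 kn leqnn.
have nfr : ~~ free (in_tuple (map fst L)).
  apply/negP; rewrite /free => /eqP sp.
  have := dimvS (subvf <<in_tuple (map fst L)>>).
  by rewrite sp size_map dimvf /dim /= muln1 -mL me addnS ltnNge leq_addr.
move: nfr; rewrite freeNE => /existsP[i ui].
have iL : (i < size L)%N by rewrite -(size_map fst).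
pose p := nth (0, 0) L i.
have pE : p.1 = (map fst L)`_i by rewrite (nth_map (0, 0)).
pose L' := take i L ++ drop i.+1 L.
have LL' : perm_eq L (p :: L').
  rewrite -{1}(cat_take_drop i L) (drop_nth (0, 0) iL).
  by rewrite -cat1s perm_catCA.
rewrite (perm_nabla _ _ (perm_map rank_one LL')) /= add0r.
have sL' : size L' = (n + e)%N.
  by have := perm_size LL'; rewrite /= -mL me addnS => -[->].
rewrite (IH _ (erefl _) L') ?sL' // subr0.
(* The column of [p] lies in the span of later ones. The difference along [p] compares two values of
   the difference along [L'], at 0 and at a sum of rank one matrices with columns taken from
   [L']. *)
have [zs szs zsE] : exists2 zs, size zs = size (map fst L')
    & rank_one p = \sum_(q <- zip (map fst L') zs) rank_one q.
  rewrite [p]surjective_pairing; apply: rank_one_span.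
  rewrite pE; apply: subvP ui; rewrite -map_drop; apply: sub_span => u.
  by rewrite map_cat mem_cat orbC => ->.
rewrite zsE -[in map rank_one L'](zip_unzip L').
apply: nabla_rank_one_translate => //; last by rewrite !size_map.
by move=> ws wss; apply: (IH _ (erefl _)); rewrite size1_zip ?size_map ?wss ?size_map ?sL'.
Qed.

End RankOneDifferences.

(** * Polynomial functions of one variable *)

Section PolynomialFunctions.

Variable F : fieldType.
Implicit Types (f g : F -> F).

Definition polyfun f : Prop := exists q : {poly F}, forall z, f z = q.[z].

Lemma polyfun_ext f g : f =1 g -> polyfun f -> polyfun g.
Proof. by move=> fg [q fE]; exists q => z; rewrite -fg. Qed.

Lemma polyfun_cst c : polyfun (fun=> c).
Proof. by exists c%:P => z; rewrite hornerC. Qed.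

Lemma polyfun_id : polyfun id.
Proof. by exists 'X => z; rewrite hornerX. Qed.

Lemma polyfunD f g : polyfun f -> polyfun g -> polyfun (fun z => f z + g z).
Proof. by move=> [q fE] [r gE]; exists (q + r) => z; rewrite hornerD fE gE. Qed.

Lemma polyfunN f : polyfun f -> polyfun (fun z => - f z).
Proof. by move=> [q fE]; exists (- q) => z; rewrite hornerN fE. Qed.

Lemma polyfunM f g : polyfun f -> polyfun g -> polyfun (fun z => f z * g z).
Proof. by move=> [q fE] [r gE]; exists (q * r) => z; rewrite hornerM fE gE. Qed.

Lemma polyfunX f k : polyfun f -> polyfun (fun z => f z ^+ k).
Proof. by move=> [q fE]; exists (q ^+ k) => z; rewrite horner_exp fE. Qed.

Lemma polyfun_sum (I : Type) (r : seq I) (P : pred I) (f : I -> F -> F) :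
  (forall i, P i -> polyfun (f i)) -> polyfun (fun z => \sum_(i <- r | P i) f i z).
Proof.
move=> fP; elim: r => [|i r IH].
  by apply: polyfun_ext (polyfun_cst 0) => z; rewrite big_nil.
case: (boolP (P i)) => Pi.
  by apply: polyfun_ext (polyfunD (fP i Pi) IH) => z; rewrite big_cons Pi.
by apply: polyfun_ext IH => z; rewrite big_cons (negPf Pi).
Qed.

Lemma polyfun_prod (I : Type) (r : seq I) (P : pred I) (f : I -> F -> F) :
  (forall i, P i -> polyfun (f i)) -> polyfun (fun z => \prod_(i <- r | P i) f i z).
Proof.
move=> fP; elim: r => [|i r IH].
  by apply: polyfun_ext (polyfun_cst 1) => z; rewrite big_nil.
case: (boolP (P i)) => Pi.
  by apply: polyfun_ext (polyfunM (fP i Pi) IH) => z; rewrite big_cons Pi.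
by apply: polyfun_ext IH => z; rewrite big_cons (negPf Pi).
Qed.

(** Polynomial curves in a space of matrices: every density argument below is reduced to such a
    curve, hence to one-variable polynomials. *)
Definition polymx m k (M : F -> 'M[F]_(m, k)) : Prop :=
  forall i j, polyfun (fun z => M z i j).

Lemma polymx_cst m k (M : 'M[F]_(m, k)) : polymx (fun=> M).
Proof. by move=> i j; apply: polyfun_cst. Qed.

Lemma polymxD m k (M N : F -> 'M[F]_(m, k)) :
  polymx M -> polymx N -> polymx (fun z => M z + N z).
Proof.
by move=> pM pN i j; apply: polyfun_ext (polyfunD (pM i j) (pN i j)) => z; rewrite mxE.
Qed.

Lemma polymxZ m k f (M : F -> 'M[F]_(m, k)) :
  polyfun f -> polymx M -> polymx (fun z => f z *: M z).
Proof.
by move=> pf pM i j; apply: polyfun_ext (polyfunM pf (pM i j)) => z; rewrite mxE.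
Qed.

Lemma polymxM m k l (M : F -> 'M[F]_(m, k)) (N : F -> 'M[F]_(k, l)) :
  polymx M -> polymx N -> polymx (fun z => M z *m N z).
Proof.
move=> pM pN i j.
apply: (@polyfun_ext (fun z => \sum_r M z i r * N z r j)) => [z|]; first by rewrite mxE.
by apply: polyfun_sum => r _; apply: polyfunM.
Qed.

Lemma polyfun_det m (M : F -> 'M[F]_m) : polymx M -> polyfun (fun z => \det (M z)).
Proof.
move=> pM; apply: polyfun_sum => s _; apply: polyfunM; first exact: polyfun_cst.
exact: polyfun_prod.
Qed.

Lemma polyfun_meval m (P : {mpoly F[m]}) (v : F -> 'I_m -> F) :
  (forall l, polyfun (v^~ l)) -> polyfun (fun z => P.@[v z]).
Proof.
move=> pv.
apply: (@polyfun_ext (fun z => \sum_(e <- msupp P) P@_e * \prod_i v z i ^+ e i)).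
  by move=> z; rewrite mevalE.
apply: polyfun_sum => e _; apply: polyfunM; first exact: polyfun_cst.
by apply: polyfun_prod => l _; apply: polyfunX.
Qed.

Lemma polyfun_lead_minor m (i : 'I_m) (M : F -> 'M[F]_m) :
  polymx M -> polyfun (fun z => lead_minor i (M z)).
Proof.
by move=> pM; apply: polyfun_det => r s; apply: polyfun_ext (pM _ _) => z; rewrite mxE.
Qed.

Lemma polyfun_highest_weight_poly m (a : 'I_m -> nat) (M : F -> 'M[F]_m) :
  polymx M -> polyfun (fun z => highest_weight_poly a (M z)).
Proof.
by move=> pM; apply: polyfun_prod => i _; apply/polyfunX/polyfun_lead_minor.
Qed.

(** Here the directions vary with the parameter too. They are functions, without decidable equality,
    hence [List.In]; [pV] stands for the polynomial curves in [V]. *)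
Lemma polyfun_nabla (V : zmodType) (pV : (F -> V) -> Prop) (f : V -> F) l x :
  (forall y z, pV y -> pV z -> pV (fun t => y t + z t)) ->
  (forall y, pV y -> polyfun (fun t => f (y t))) ->
  pV x -> (forall d, List.In d l -> pV d) ->
  polyfun (fun t => nabla [seq d t | d <- l] f (x t)).
Proof.
move=> pD pf; elim: l x => [|d l IH] x px pl; first exact: pf.
have pl' e : List.In e l -> pV e by move=> el; apply: pl; right.
apply: polyfunD; last exact/polyfunN/IH.
by apply: IH => //; apply: pD => //; apply: pl; left.
Qed.

End PolynomialFunctions.

(** * Density on the affine line *)

Section ClosedField.

Variable F : closedFieldType.
Implicit Types (f g : F -> F).

Lemma polyfun_eq0 f g : polyfun f -> polyfun g -> (exists z, g z != 0) ->
  (forall z, g z != 0 -> f z = 0) -> forall z, f z = 0.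
Proof.
move=> [q fE] [r gE] [z0 gz0] fg z; rewrite fE.
suff -> : q = 0 by rewrite horner0.
apply/eqP/negP => /negP q0.
have r0 : r != 0 by apply: contraNneq gz0 => r0; rewrite gE r0 horner0.
have : q * r != 0 by rewrite mulf_neq0.
move=> /closed_nonrootP[y]; rewrite rootE hornerM mulf_eq0 negb_or => /andP[qy ry].
by case/eqP: qy; rewrite -fE fg // gE.
Qed.

(** Roots of unity of order prime to the characteristic; the invertible exponent is what gives
    semisimplicity later. *)
Definition torsion (z : F) : Prop := exists2 r : nat, r%:R != 0 :> F & z ^+ r = 1.

(** If [r] is non-zero in [F], then ['X^r - 1] is separable and has [r] torsion roots, too many for
    a non-zero polynomial once [r] is at least its size. *)
Lemma polyfun_torsion_eq0 f :
  polyfun f -> (forall z, torsion z -> f z = 0) -> forall z, f z = 0.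
Proof.
move=> [q fE] ft z; rewrite fE; suff -> : q = 0 by rewrite horner0.
apply/eqP/negP => /negP q0.
(* Of two consecutive integers one is non-zero in [F]. *)
have [r rq r0] : exists2 r, (size q <= r)%N & r%:R != 0 :> F.
  have [s0|] := eqVneq ((size q)%:R : F) 0; last by exists (size q).
  by exists (size q).+1; rewrite ?leqnSn // -addn1 natrD s0 add0r oner_eq0.
have rp : (0 < r)%N by apply: leq_trans rq; rewrite size_poly_gt0.
have [s sE] := closed_field_poly_normal ('X^r - 1 : {poly F}).
have lc : lead_coef ('X^r - 1 : {poly F}) = 1.
  by apply/eqP; rewrite -monicE monicXnsubC.
rewrite lc scale1r in sE.
have us : uniq s by rewrite -separable_prod_XsubC -sE separable_Xn_sub_1.
have ss : size s = r.
  by have := congr1 (fun p : {poly F} => size p) sE; rewrite size_prod_XsubC size_XnsubC // => -[].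
suff : (size s < size q)%N by rewrite ss ltnNge rq.
apply: max_poly_roots => //; apply/allP => x xs.
rewrite rootE -fE ft //; exists r => //.
have : root ('X^r - 1 : {poly F}) x by rewrite sE root_prod_XsubC.
by rewrite rootE hornerD hornerN hornerXn hornerC subr_eq0 => /eqP.
Qed.

End ClosedField.

(** * The symplectic group and transvections *)

Section Symplectic.

Variables (F : fieldType) (n : nat).
Local Notation J := (witt_gram F n).
Implicit Types (g h : 'M[F]_(n + n)) (u v w : 'cV[F]_(n + n)).

Definition flip_mx : 'M[F]_n := \matrix_(i, j) (j == rev_ord i)%:R.

Lemma witt_gramE : J = block_mx 0 flip_mx (- flip_mx) 0.
Proof. by []. Qed.

Lemma flip_mul k (A : 'M[F]_(n, k)) i j : (flip_mx *m A) i j = A (rev_ord i) j.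
Proof.
rewrite mxE (bigD1 (rev_ord i)) //= mxE eqxx mul1r big1 ?addr0 // => l li.
by rewrite mxE (negPf li) mul0r.
Qed.

Lemma mul_flip k (A : 'M[F]_(k, n)) i j : (A *m flip_mx) i j = A i (rev_ord j).
Proof.
rewrite mxE (bigD1 (rev_ord j)) //= mxE rev_ordK eqxx mulr1 big1 ?addr0 // => l lj.
by rewrite mxE eq_sym (can2_eq rev_ordK rev_ordK) (negPf lj) mulr0.
Qed.

Lemma flip_mxT : flip_mx^T = flip_mx.
Proof. by apply/matrixP=> i j; rewrite !mxE [in RHS]eq_sym (can2_eq rev_ordK rev_ordK). Qed.

Lemma flip_mxK : flip_mx *m flip_mx = 1%:M.
Proof. by apply/matrixP=> i j; rewrite flip_mul !mxE rev_ordK eq_sym. Qed.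

Lemma witt_gramT : J^T = - J.
Proof.
by rewrite witt_gramE tr_block_mx opp_block_mx !trmx0 linearN /= flip_mxT oppr0 opprK.
Qed.

Lemma witt_gram_sqr : J *m J = - 1%:M.
Proof.
rewrite witt_gramE mulmx_block !mul0mx !mulmx0 !addr0 !add0r mulNmx mulmxN flip_mxK.
by rewrite scalar_mx_block opp_block_mx oppr0.
Qed.

Lemma Sp1 : Sp (1%:M : 'M[F]_(n + n)).
Proof. by rewrite /Sp trmx1 mul1mx mulmx1. Qed.

Lemma SpM g h : Sp g -> Sp h -> Sp (g *m h).
Proof. by rewrite /Sp trmx_mul => gS hS; rewrite !mulmxA -(mulmxA h^T) -(mulmxA h^T) gS. Qed.

(** The inverse [J^-1 g^T J] of a symplectic [g], where [J^-1 = - J]. *)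
Definition spinv g : 'M[F]_(n + n) := - (J *m g^T *m J).

Lemma spinvK g : Sp g -> spinv g *m g = 1%:M.
Proof.
by move=> gS; rewrite /spinv mulNmx -!mulmxA (mulmxA g^T) gS witt_gram_sqr opprK.
Qed.

Lemma spinvKr g : Sp g -> g *m spinv g = 1%:M.
Proof. by move=> gS; apply/mulmx1C/spinvK. Qed.

Lemma Sp_gram_tr g : Sp g -> g *m J *m g^T = J.
Proof.
move=> /spinvKr; rewrite /spinv mulmxN => /(congr1 (fun M => M *m J)).
by rewrite !mulmxA mulNmx -!mulmxA witt_gram_sqr !mulmxN mulmx1 opprK mul1mx !mulmxA.
Qed.

Lemma Sp_inv g : Sp g -> Sp (spinv g).
Proof.
move=> gS; have gT : (spinv g)^T = - (J *m g *m J).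
  rewrite /spinv raddfN /= !trmx_mul trmxK witt_gramT.
  by rewrite !(mulNmx, mulmxN, opprK) mulmxA.
rewrite /Sp gT /spinv !(mulNmx, mulmxN) opprK -!mulmxA (mulmxA J J) witt_gram_sqr.
rewrite !(mulNmx, mulmxN, mul1mx) (mulmxA g) (mulmxA (g *m J)) Sp_gram_tr //.
by rewrite witt_gram_sqr mulmxN mulmx1 opprK.
Qed.

Lemma sformDl u v w : sform (u + v) w = sform u w + sform v w.
Proof. by rewrite /sform linearD /= !mulmxDl mxE. Qed.

Lemma sformDr u v w : sform u (v + w) = sform u v + sform u w.
Proof. by rewrite /sform mulmxDr mxE. Qed.

Lemma sformZl c u v : sform (c *: u) v = c * sform u v.
Proof. by rewrite /sform linearZ /= -!scalemxAl mxE. Qed.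

Lemma sformZr c u v : sform u (c *: v) = c * sform u v.
Proof. by rewrite /sform -scalemxAr mxE. Qed.

Lemma sformNl u v : sform (- u) v = - sform u v.
Proof. by rewrite -scaleN1r sformZl mulN1r. Qed.

Lemma sformNr u v : sform u (- v) = - sform u v.
Proof. by rewrite -scaleN1r sformZr mulN1r. Qed.

Lemma sform_sumr (I : Type) (r : seq I) (P : pred I) u (f : I -> 'cV[F]_(n + n)) :
  sform u (\sum_(i <- r | P i) f i) = \sum_(i <- r | P i) sform u (f i).
Proof.
elim/big_rec2: _ => [|i x y _ <-]; last by rewrite sformDr.
by rewrite -(scale0r 0) sformZr mul0r.
Qed.

Lemma sformC u v : sform u v = - sform v u.
Proof.
have -> : sform u v = (v^T *m J^T *m u) 0 0.
  by rewrite -{2}[u]trmxK -!trmx_mul [in RHS]mxE mulmxA.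
by rewrite witt_gramT mulmxN mulNmx mxE.
Qed.

(** Computed on blocks, because [sformC] gives no information on [sform u u] in characteristic 2. *)
Lemma sform_alt u : sform u u = 0.
Proof.
rewrite /sform -[u]vsubmxK; set a := usubmx u; set b := dsubmx u.
rewrite tr_col_mx witt_gramE mul_row_block !mulmx0 add0r addr0 mul_row_col mxE mulmxN mulNmx.
rewrite [in X in X + _]mxE.
have -> : (b^T *m flip_mx *m a) 0 0 = ((b^T *m flip_mx *m a)^T) 0 0 by rewrite [in RHS]mxE.
by rewrite !trmx_mul trmxK flip_mxT mulmxA addNr.
Qed.

Lemma sform_Sp g u v : Sp g -> sform (g *m u) (g *m v) = sform u v.
Proof.
rewrite /Sp /sform => {2}<-; by rewrite trmx_mul !mulmxA.
Qed.

Lemma sform_inv g u v : Sp g -> sform (spinv g *m u) v = sform u (g *m v).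
Proof. by move=> gS; rewrite -(sform_Sp _ _ gS) mulmxA spinvKr // mul1mx. Qed.

Definition transvection v (c : F) : 'M[F]_(n + n) := 1%:M + c *: (v *m (v^T *m J)).

Lemma transvectionE v c u : transvection v c *m u = u + (c * sform v u) *: v.
Proof.
rewrite mulmxDl mul1mx -scalemxAl -mulmxA -scalerA; congr (_ + _ *: _).
by rewrite [v^T *m J *m u]mx11_scalar mul_mx_scalar.
Qed.

Lemma transvection_Sp v c : Sp (transvection v c).
Proof.
have vv : v^T *m J *m v = 0.
  by rewrite [LHS]mx11_scalar -/(sform v v) sform_alt; apply/matrixP=> i j; rewrite !mxE mul0rn.
have tT : (transvection v c)^T = 1%:M - c *: (J *m v *m v^T).
  rewrite /transvection raddfD /= trmx1 linearZ /= !trmx_mul trmxK witt_gramT.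
  by rewrite !mulNmx scalerN.
rewrite /Sp tT /transvection mulmxBl mul1mx mulmxDr mulmx1 mulmxBl.
rewrite -!scalemxAl -!scalemxAr !mulmxA.
have -> : J *m v *m v^T *m J *m v = 0 by rewrite -!mulmxA (mulmxA v^T) vv !mulmx0.
by rewrite mul0mx mul0mx !scaler0 subr0 subrK.
Qed.

(** The common factor [z] turns a product of transvections into a curve from the identity, at
    [z = 0], to the product, at [z = 1]. *)
Definition transvections (l : seq ('cV[F]_(n + n) * F)) (z : F) : 'M[F]_(n + n) :=
  foldr (fun p => mulmx (transvection p.1 (z * p.2))) 1%:M l.

Lemma transvections_cat l1 l2 z :
  transvections (l1 ++ l2) z = transvections l1 z *m transvections l2 z.
Proof. by elim: l1 => [|p l1 IH] /=; rewrite ?mul1mx // IH mulmxA. Qed.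

Lemma transvections_Sp l z : Sp (transvections l z).
Proof. by elim: l => [|p l IH] /=; [exact: Sp1|exact/SpM/IH/transvection_Sp]. Qed.

Lemma transvections0 l : transvections l 0 = 1%:M.
Proof. by elim: l => [|p l /= ->] //; rewrite mul0r /transvection scale0r addr0 mulmx1. Qed.

Lemma polymx_transvections l : polymx (transvections l).
Proof.
elim: l => [|p l IH] /=; first exact: polymx_cst.
apply: (@polymxM _ _ _ _ (fun z => transvection p.1 (z * p.2))) IH.
apply: polymxD; first exact: polymx_cst.
apply: polymxZ; last exact: polymx_cst.
by apply: polyfunM; [exact: polyfun_id|exact: polyfun_cst].
Qed.

Lemma transvections_fix l z u : {in l, forall p, sform u p.1 = 0} ->
  transvections l z *m u = u.
Proof.
elim: l => [|p l IH] ul /=; first exact: mul1mx.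
rewrite -mulmxA IH => [|q ql]; last by rewrite ul // inE ql orbT.
by rewrite transvectionE sformC ul ?mem_head // oppr0 mulr0 scale0r addr0.
Qed.

Lemma transvection_move u v : sform u v != 0 ->
  transvection (v - u) (sform v u)^-1 *m u = v.
Proof.
rewrite sformC oppr_eq0 => uv0.
by rewrite transvectionE sformDl sformNl sform_alt subr0 mulVf // scale1r addrC subrK.
Qed.

(** * Transitivity on hyperbolic pairs *)

Section Hyperbolic.

Variable S : 'cV[F]_(n + n) -> Prop.
Hypothesis SZD : forall c u v, S u -> S v -> S (u + c *: v).

Let SD u v : S u -> S v -> S (u + v).
Proof. by move=> Su Sv; rewrite -[v]scale1r; apply: SZD. Qed.

Let SB u v : S u -> S v -> S (u - v).
Proof. by move=> Su Sv; rewrite -scaleN1r; apply: SZD. Qed.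

(** A detour through [w], which serves when [u] and [v] are orthogonal. The directions are recorded
    so as to find the vectors left fixed. *)
Lemma transvections_move u v w : S u -> S v -> S w ->
  sform u w != 0 -> sform w v != 0 ->
  exists2 l, {in l, forall p, S p.1 /\ (p.1 = w - u \/ p.1 = v - w)}
    & transvections l 1 *m u = v.
Proof.
move=> Su Sv Sw uw wv.
exists [:: (v - w, (sform v w)^-1); (w - u, (sform w u)^-1)].
  by move=> p; rewrite !inE => /orP[]/eqP -> /=; split; auto.
by rewrite /= !mul1r mulmx1 -mulmxA !transvection_move.
Qed.

(** First [e] is moved to [e']; then the image of [f] is moved to [f'] along directions orthogonal
    to [e'], which leave [e'] fixed. *)
Lemma hyperbolic_pair_move e f e' f' : S e -> S f -> S e' -> S f' ->
  sform e f = 1 -> sform e' f' = 1 ->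
  exists l, [/\ {in l, forall p, S p.1}, transvections l 1 *m e = e'
              & transvections l 1 *m f = f'].
Proof.
move=> Se Sf Se' Sf' ef ef'.
have [l1 Sl1 l1e] : exists2 l, {in l, forall p, S p.1} & transvections l 1 *m e = e'.
  have via w : S w -> sform e w != 0 -> sform w e' != 0 ->
      exists2 l, {in l, forall p, S p.1} & transvections l 1 *m e = e'.
    move=> Sw ew we'; have [l lS le] := transvections_move Se Se' Sw ew we'.
    by exists l => // p /lS[].
  (* The intermediate vector is [f], [f'] or [f + f'], whichever is non-orthogonal to both [e] and
     [e']. *)
  have [e'f0|e'f] := eqVneq (sform e' f) 0; last first.
    by apply: (via f) => //; rewrite ?ef ?oner_eq0 // sformC oppr_eq0.
  have [ef'0|ef'n] := eqVneq (sform e f') 0; last first.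
    by apply: (via f') => //; rewrite sformC ef' oppr_eq0 oner_eq0.
  apply: (via (f + f')); first exact: SD.
    by rewrite sformDr ef ef'0 addr0 oner_eq0.
  by rewrite sformC sformDr e'f0 ef' add0r oppr_eq0 oner_eq0.
set g1 := transvections l1 1 in l1e; set f1 := g1 *m f.
have e'f1 : sform e' f1 = 1 by rewrite -l1e sform_Sp //; apply: transvections_Sp.
have Sf1 : S f1.
  rewrite /f1 /g1; elim: l1 Sl1 {l1e g1 f1 e'f1} => [|p l IH] Sl; first by rewrite mul1mx.
  rewrite /= -mulmxA transvectionE; apply: SZD; last exact: Sl (mem_head _ _).
  by apply: IH => q ql; apply: Sl; rewrite inE ql orbT.
have [l2 Sl2 l2f] : exists2 l, {in l, forall p, S p.1 /\ sform e' p.1 = 0}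
    & transvections l 1 *m f1 = f'.
  have e'e' := sform_alt e'.
  have via w : S w -> sform e' w = 1 -> sform f1 w != 0 -> sform w f' != 0 ->
      exists2 l, {in l, forall p, S p.1 /\ sform e' p.1 = 0}
        & transvections l 1 *m f1 = f'.
    move=> Sw e'w fw wf'; have [l lS lf] := transvections_move Sf1 Sf' Sw fw wf'.
    exists l => // p /lS[Sp pE]; split => //; case: pE => ->.
      by rewrite sformDr sformNr e'w e'f1 subrr.
    by rewrite sformDr sformNr e'w ef' subrr.
  (* If [f1] and [f'] are orthogonal, [f1 + e'] is a suitable intermediate vector; otherwise a
     single transvection is enough. *)
  have [f1f'|f1f'] := eqVneq (sform f1 f') 0.
    apply: (via (f1 + e')); first exact: SD.
    - by rewrite sformDr e'f1 e'e' addr0.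
    - by rewrite sformDr sform_alt add0r sformC e'f1 oppr_eq0 oner_eq0.
    - by rewrite sformDl f1f' ef' add0r oner_eq0.
  exists [:: (f' - f1, (sform f' f1)^-1)].
    move=> p; rewrite inE => /eqP -> /=; split; first exact: SB.
    by rewrite sformDr sformNr e'f1 ef' subrr.
  by rewrite /= mul1r mulmx1 transvection_move.
exists (l2 ++ l1); rewrite transvections_cat -!mulmxA -/g1 l1e; split => //.
  by move=> p; rewrite mem_cat => /orP[/Sl2[]|/Sl1].
by apply: transvections_fix => p /Sl2[].
Qed.

End Hyperbolic.

Definition std_e (i : 'I_n) : 'cV[F]_(n + n) := delta_mx (lshift n i) 0.
(** The partner of [std_e i] sits in position [n + (n - 1 - i)]. *)
Definition std_f (i : 'I_n) : 'cV[F]_(n + n) := delta_mx (rshift n (rev_ord i)) 0.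

Lemma sform_delta i j : sform (delta_mx i 0) (delta_mx j 0) = J i j.
Proof. by rewrite /sform trmx_delta -rowE -colE !mxE. Qed.

Lemma sform_std_ee i j : sform (std_e i) (std_e j) = 0.
Proof. by rewrite sform_delta witt_gramE block_mxEul mxE. Qed.

Lemma sform_std_ff i j : sform (std_f i) (std_f j) = 0.
Proof. by rewrite sform_delta witt_gramE block_mxEdr mxE. Qed.

Lemma sform_std_ef i j : sform (std_e i) (std_f j) = (i == j)%:R.
Proof. by rewrite sform_delta witt_gramE block_mxEur mxE (inj_eq rev_ord_inj) eq_sym. Qed.

Definition hyperbolic (m : nat) (e f : 'I_n -> 'cV[F]_(n + n)) : Prop :=
  forall i j : 'I_n, (i < m)%N -> (j < m)%N ->
  [/\ sform (e i) (e j) = 0, sform (f i) (f j) = 0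
    & sform (e i) (f j) = (i == j)%:R].

(** Induction on the number of pairs. The new pair and its target both lie in the orthogonal [S] of
    the pairs already placed, and transvections along [S] do not disturb these. *)
Lemma witt_extension m e f : hyperbolic m e f ->
  exists l, forall i : 'I_n, (i < m)%N ->
    transvections l 1 *m std_e i = e i /\ transvections l 1 *m std_f i = f i.
Proof.
elim: m => [|m IH] ef; first by exists [::].
have [|l lE] := IH; first by move=> i j im jm; apply: ef; apply: ltnW.
have [nm|mn] := leqP n m.
  by exists l => i _; apply: lE; apply: leq_trans nm.
pose j := Ordinal mn.
have lS := transvections_Sp l 1.
set g := transvections l 1 in lE lS.
pose S u := forall i : 'I_n, (i < m)%N -> sform (e i) u = 0 /\ sform (f i) u = 0.
have SZD c u v : S u -> S v -> S (u + c *: v).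
  move=> Su Sv i im; have [eu fu] := Su i im; have [ev fv] := Sv i im.
  by rewrite !sformDr !sformZr eu ev fu fv !mulr0 !addr0.
have ij (i : 'I_n) : (i < m)%N -> (i == j) = false.
  by move=> im; apply/negbTE; rewrite neq_ltn im.
have efj := ef j j (ltnSn m) (ltnSn m); rewrite eqxx in efj.
have [l' [Sl' l'e l'f]] : exists l', [/\ {in l', forall p, S p.1},
    transvections l' 1 *m (g *m std_e j) = e j
    & transvections l' 1 *m (g *m std_f j) = f j].
  apply: hyperbolic_pair_move => //.
  - move=> i im; have [<- <-] := lE i im.
    by rewrite !sform_Sp // sform_std_ee sformC sform_std_ef eq_sym ij // oppr0.
  - move=> i im; have [<- <-] := lE i im.
    by rewrite !sform_Sp // sform_std_ff sform_std_ef ij.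
  - move=> i im; have [-> _ _] := ef i j (ltnW im) (ltnSn m).
    have [_ _ fe] := ef j i (ltnSn m) (ltnW im).
    by rewrite sformC fe eq_sym ij // oppr0.
  - move=> i im; have [_ -> ->] := ef i j (ltnW im) (ltnSn m).
    by rewrite ij.
  - by rewrite sform_Sp // sform_std_ef eqxx.
  - by case: efj.
exists (l' ++ l) => i; rewrite transvections_cat -!mulmxA ltnS leq_eqVlt.
case/orP => [/eqP im|im].
  by have -> : i = j by apply: val_inj.
have [-> ->] := lE i im.
by split; apply: transvections_fix => p /Sl'/(_ i im)[].
Qed.

Lemma col_std g h : (forall i, g *m std_e i = h *m std_e i) ->
  (forall i, g *m std_f i = h *m std_f i) -> g = h.
Proof.
move=> ge gf; apply/trmx_inj/row_matrixP => i; rewrite -!tr_col; congr _^T.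
rewrite !colE; case: (split_ordP i) => r ->; first exact: ge.
by rewrite -[r]rev_ordK; apply: gf.
Qed.

Lemma Sp_transvections g : Sp g -> exists l, transvections l 1 = g.
Proof.
move=> gS; have [|l lE] := @witt_extension n (fun i => g *m std_e i) (fun i => g *m std_f i).
  by move=> i j _ _; rewrite !sform_Sp // sform_std_ee sform_std_ff sform_std_ef.
by exists l; apply: col_std => i; have [] := lE i (ltn_ord i).
Qed.

Definition Sp_lower (u : 'M[F]_(n + n)) : Prop :=
  Sp u /\ forall i j : 'I_(n + n), (i <= j)%N -> u i j = (i == j)%:R.

Lemma Sp_block_diag (a b : 'M[F]_n) :
  a^T *m flip_mx *m b = flip_mx -> Sp (block_mx a 0 0 b).
Proof.
move=> ab; have ba : b^T *m flip_mx *m a = flip_mx.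
  by apply: trmx_inj; rewrite !trmx_mul trmxK flip_mxT mulmxA ab.
rewrite /Sp witt_gramE tr_block_mx !trmx0 !mulmx_block.
by rewrite !(mul0mx, mulmx0, addr0, add0r) ab mulmxN mulNmx ba.
Qed.

Lemma torus_eltE (t : 'rV[F]_n) :
  torus_elt t = block_mx (diag_mx t) 0 0 (diag_mx (\row_i (t 0 (rev_ord i))^-1)).
Proof. exact: diag_mx_row. Qed.

Lemma torus_elt_Sp (t : 'rV[F]_n) : (forall i, t 0 i != 0) -> Sp (torus_elt t).
Proof.
move=> t0; rewrite torus_eltE; apply: Sp_block_diag.
apply/matrixP => i j; rewrite tr_diag_mx mul_mx_diag mul_diag_mx !mxE.
case: (eqVneq j (rev_ord i)) => [->|_]; last by rewrite mulr0 mul0r.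
by rewrite rev_ordK mulr1 mulfV.
Qed.

End Symplectic.

(** * The highest weight coefficient *)

Section RationalRepresentation.

Variables (F : closedFieldType) (n d : nat).
Variable rho : 'M[F]_(n + n) -> 'M[F]_d.
Hypothesis hrho : rational_representation rho.

Local Notation J := (witt_gram F n).

Lemma rho1 : rho 1%:M = 1%:M.
Proof. exact: rr_one hrho. Qed.

Lemma rhoM g h : Sp g -> Sp h -> rho (g *m h) = rho g *m rho h.
Proof. by move=> gS hS; apply: (rr_mul hrho). Qed.

Lemma polymx_rho : exists P : 'I_d -> 'I_d -> {mpoly F[(n + n) * (n + n)]},
  forall g, Sp g -> rho g = \matrix_(i, j) (P i j).@[fun l => mxvec g 0 l].
Proof.
have /fin_all_exists[P PE] : forall i, exists Pi : 'I_d -> {mpoly F[(n + n) * (n + n)]},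
    forall j g, Sp g -> rho g i j = (Pi j).@[fun l => mxvec g 0 l].
  by move=> i; apply: (fin_all_exists (rr_regular hrho i)).
by exists P => g gS; apply/matrixP => i j; rewrite mxE PE.
Qed.

Lemma poly_of_polymx m k (M : F -> 'M[F]_(m, k)) : polymx M ->
  exists Q : 'M[{poly F}]_(m, k), forall z i j, M z i j = (Q i j).[z].
Proof.
move=> pM; have /fin_all_exists[Q QE] : forall i, exists Qi : 'I_k -> {poly F},
    forall j z, M z i j = (Qi j).[z].
  by move=> i; apply: (fin_all_exists (pM i)).
by exists (\matrix_(i, j) Q i j) => z i j; rewrite mxE.
Qed.

Lemma poly_ext (p q : {poly F}) : (forall z, z != 0 -> p.[z] = q.[z]) -> p = q.
Proof.
move=> pq; apply/eqP; rewrite -subr_eq0; apply/negP => /negP.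
move=> pq0; have /closed_nonrootP[z] : (p - q) * 'X != 0 by rewrite mulf_neq0 ?polyX_eq0.
by rewrite rootE !hornerE mulf_eq0 negb_or subr_eq0 => /andP[/eqP npq /pq].
Qed.

(** Every monomial of [P] has degree at most [K], so the factor [z ^+ (m * K)] clears all
    denominators. *)
Lemma meval_scaled (P : {mpoly F[(n + n) * (n + n)]}) (K m : nat)
    (v : F -> 'I_((n + n) * (n + n)) -> F) : (msize P <= K)%N ->
  (forall l, polyfun (v^~ l)) ->
  exists q : {poly F}, forall z, z != 0 ->
    q.[z] = z ^+ (m * K) * P.@[fun l => v z l / z ^+ m].
Proof.
move=> PK pv.
have [q qE] : polyfun (fun z => \sum_(e <- msupp P) P@_e
    * (z ^+ (m * (K - mdeg e)) * \prod_l v z l ^+ e l)).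
  apply: polyfun_sum => e _; apply: polyfunM; first exact: polyfun_cst.
  apply: polyfunM; first exact/polyfunX/polyfun_id.
  by apply: polyfun_prod => l _; apply: polyfunX.
exists q => z z0; rewrite -qE mevalE mulr_sumr; apply: eq_big_seq => e eP.
rewrite [RHS]mulrCA; congr (_ * _).
have -> : \prod_l (v z l / z ^+ m) ^+ e l
          = \prod_l v z l ^+ e l * (z ^+ (m * mdeg e))^-1.
  rewrite mdegE big_distrr /= -prodrXr -prodfV -big_split /=.
  by apply: eq_bigr => l _; rewrite expr_div_n exprM.
have eK : (mdeg e <= K)%N by apply: leq_trans (ltnW _) PK; apply: msize_mdeg_lt.
rewrite mulrCA [LHS]mulrC; congr (_ * _).
apply: (mulIf (expf_neq0 (m * mdeg e)%N z0)).
by rewrite -exprD -mulnDr subnK // mulfVK // expf_neq0.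
Qed.

(** The torus element has diagonal entries [z ^ (contraction_exponent r - n)]. The exponent skips
    [n], so that it increases strictly and is symmetric about [n], as the symplectic pairing
    requires. *)
Definition contraction_exponent (r : 'I_(n + n)) : nat := r + (n <= r).

Definition contraction_torus (z : F) : 'rV[F]_n := \row_i (z ^+ i / z ^+ n).

Lemma contraction_torusE (z : F) r s : z != 0 ->
  torus_elt (contraction_torus z) r s
    = (r == s)%:R * z ^+ contraction_exponent r / z ^+ n.
Proof.
move=> z0; rewrite /torus_elt mxE; case: eqVneq => _; last by rewrite !mul0r.
rewrite mulr1n mul1r /contraction_exponent; case: (split_ordP r) => i ->.
  by rewrite row_mxEl mxE /= leqNgt ltn_ord addn0.
rewrite row_mxEr !mxE /= leq_addr addn1 invf_div.
have zn : z ^+ n = z ^+ i.+1 * z ^+ (n - i.+1) by rewrite -exprD subnKC.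
by rewrite {1}zn mulfK ?expf_neq0 // -addnS exprD mulrAC mulfV ?expf_neq0 // mul1r.
Qed.

(* A strictly dominant one-parameter subgroup [gamma] of the torus contracts a
   lower unipotent [u] to 1, so the lowest coefficient of [rho (gamma z)] absorbs
   [rho u] on the right. *)
Lemma lower_invariant : (0 < d)%N ->
  exists2 f : 'rV[F]_d, f != 0 & forall u, Sp_lower u -> f *m rho u = f.
Proof.
move=> d0; have [P PE] := polymx_rho.
pose gam z := torus_elt (contraction_torus z).
have gamS z : z != 0 -> Sp (gam z).
  by move=> z0; apply: torus_elt_Sp => i; rewrite mxE mulf_neq0 ?invr_eq0 ?expf_neq0.
pose K := (\max_i \max_j msize (P i j))%N.
have PK i j : (msize (P i j) <= K)%N.
  exact: leq_trans (leq_bigmax (F := fun j => msize (P i j)) j)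
    (leq_bigmax (F := fun i => \max_j msize (P i j))%N i).
have [Q QE] : exists Q : 'M[{poly F}]_d, forall z, z != 0 ->
    forall i j, (Q i j).[z] = z ^+ (n * K) * rho (gam z) i j.
  pose v z l := mxvec (\matrix_(r, s) ((r == s)%:R * z ^+ contraction_exponent r)
                       : 'M[F]_(n + n)) 0 l.
  have pv l : polyfun (v^~ l).
    case/mxvec_indexP: l => r s.
    apply: (@polyfun_ext _ (fun z => (r == s)%:R * z ^+ contraction_exponent r)).
      by move=> z; rewrite /v mxvecE mxE.
    apply: polyfunM; first exact: polyfun_cst.
    exact/polyfunX/polyfun_id.
  have /fin_all_exists[Q QE] : forall i, exists Qi : 'I_d -> {poly F},
      forall j z, z != 0 -> (Qi j).[z] = z ^+ (n * K) * (P i j).@[fun l => v z l / z ^+ n].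
    by move=> i; apply: (fin_all_exists (fun j => meval_scaled n (PK i j) pv)).
  exists (\matrix_(i, j) Q i j) => z z0 i j; rewrite mxE QE // (PE _ (gamS _ z0)) mxE.
  congr (_ * _); apply: meval_eq => l; case/mxvec_indexP: l => r s.
  by rewrite /v !mxvecE mxE contraction_torusE.
have Q0 : exists e, map_mx (coefp e) Q != 0.
  have [i0 _] : exists i : 'I_d, true by exists (Ordinal d0).
  have : Q i0 i0 != 0.
    apply: contra_eq_neq (QE 1 (oner_neq0 _) i0 i0) => ->.
    have -> : gam 1 = 1%:M.
      apply/matrixP => r s; rewrite contraction_torusE ?oner_neq0 //.
      by rewrite !expr1n divr1 mulr1 mxE.
    by rewrite rho1 mxE eqxx expr1n mulr1 horner0 eq_sym oner_eq0.
  rewrite -lead_coef_eq0 lead_coefE => Qi; exists (size (Q i0 i0)).-1.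
  by apply: contraNneq Qi => /matrixP /(_ i0 i0); rewrite !mxE /= => ->.
(* [e] is the lowest power of [z] occurring in [Q]. *)
case: (ex_minnP Q0) => e Qe Qmin.
have low k i j : (k < e)%N -> (Q i j)`_k = 0.
  move=> ke; have : map_mx (coefp k) Q == 0.
    by apply: contraLR ke => /Qmin; rewrite -leqNgt.
  by move=> /eqP/matrixP/(_ i j); rewrite !mxE.
have Qu u : Sp_lower u -> map_mx (coefp e) Q *m rho u = map_mx (coefp e) Q.
  move=> [uS uL].
  (* For [z != 0] this is the conjugate of [u] by [gam z]. As [u] is lower triangular and the
     exponents increase, no negative power occurs, and [C 0] is the identity. *)
  pose C z : 'M[F]_(n + n) :=
    \matrix_(r, s) (u r s * z ^+ (contraction_exponent r - contraction_exponent s)).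
  have pC : polymx (fun z => \matrix_(i, j) (P i j).@[fun l => mxvec (C z) 0 l]).
    move=> i j; apply: (@polyfun_ext _ (fun z => (P i j).@[fun l => mxvec (C z) 0 l])).
      by move=> z; rewrite mxE.
    apply: polyfun_meval => l; case/mxvec_indexP: l => r s.
    apply: (@polyfun_ext _ (fun z =>
      u r s * z ^+ (contraction_exponent r - contraction_exponent s))).
      by move=> z; rewrite mxvecE mxE.
    apply: polyfunM; first exact: polyfun_cst.
    exact/polyfunX/polyfun_id.
  have [B BE] := poly_of_polymx pC.
  have CE z : z != 0 -> C z *m gam z = gam z *m u.
    move=> z0; have -> : gam z = diag_mx (\row_r (z ^+ contraction_exponent r / z ^+ n)).
      apply/matrixP => r s; rewrite contraction_torusE // !mxE -mulrA.
      by case: eqVneq => _; rewrite ?mul1r ?mul0r.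
    apply/matrixP => r s; rewrite mul_mx_diag mul_diag_mx !mxE.
    have [rs|sr] := ltnP r s.
      by rewrite uL ?(ltnW rs) // -val_eqE /= ltn_eqF //= !mul0r mulr0.
    rewrite mulrA -(mulrA (u r s)) -exprD subnK; first by rewrite [RHS]mulrC mulrA.
    by rewrite leq_add //; case: (leqP n s) => // /leq_trans ->.
  have CS z : z != 0 -> Sp (C z).
    move=> z0; have -> : C z = gam z *m u *m spinv (gam z).
      by rewrite -CE // -mulmxA (spinvKr (gamS _ z0)) mulmx1.
    by apply: SpM; [apply: SpM (gamS _ z0) uS | apply/Sp_inv/gamS].
  have C0 : C 0 = 1%:M.
    apply/matrixP => r s; rewrite !mxE; have [rs|sr] := leqP r s; last first.
      rewrite expr0n subn_eq0 leqNgt (_ : _ < _)%N ?mulr0; last first.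
        by rewrite /contraction_exponent -addSn leq_add //; case: (leqP n s) => // /leq_trans ->
          //; apply: ltnW.
      by rewrite -val_eqE gtn_eqF.
    rewrite uL //; case: eqP => [->|_]; last by rewrite mul0r.
    by rewrite subnn expr0 mulr1.
  have B0 i j : (B i j)`_0 = (i == j)%:R.
    rewrite -horner_coef0 -BE C0 -(PE _ (Sp1 _ _)) rho1.
    by rewrite [LHS]mxE.
  (* In the coefficient of [z ^ e] only the constant term of [B], the identity, meets the lowest
     coefficient of [Q]. *)
  have QB i j : \sum_k Q i k * (rho u k j)%:P = \sum_k B i k * Q k j.
    apply: poly_ext => z z0; rewrite !horner_sum.
    have /matrixP/(_ i j) : rho (gam z) *m rho u = rho (C z) *m rho (gam z).
      by rewrite -(rhoM (gamS _ z0) uS) -(rhoM (CS _ z0) (gamS _ z0)) CE.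
    rewrite !mxE => /(congr1 (fun x => z ^+ (n * K) * x)); rewrite !mulr_sumr => E.
    under eq_bigr => k _ do rewrite hornerM hornerC QE // -mulrA.
    rewrite E; apply: eq_bigr => k _; rewrite hornerM QE // -BE mulrCA.
    by rewrite (PE _ (CS _ z0)) !mxE.
  apply/matrixP => i j; rewrite !mxE.
  have := congr1 (fun p : {poly F} => p`_e) (QB i j); rewrite /= !coef_sum.
  rewrite (eq_bigr (fun k => (Q i k)`_e * rho u k j)); last by move=> k _; rewrite coefMC.
  rewrite (eq_bigr (fun k => map_mx (coefp e) Q i k * rho u k j)); last first.
    by move=> k _; rewrite mxE.
  move=> ->; rewrite (bigD1 i) //= big1 ?addr0 => [|k ki]; last first.
    rewrite coefM big_ord_recl B0 eq_sym (negPf ki) mul0r add0r big1 // => l _.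
    by rewrite low ?mulr0 // ltn_subrL /=; case: (e) l => [[]|].
  rewrite coefM big_ord_recl B0 eqxx mul1r subn0 big1 ?addr0 // => l _.
  by rewrite low ?mulr0 // ltn_subrL /=; case: (e) l => [[]|].
have [i Qi] : exists i, row i (map_mx (coefp e) Q) != 0.
  apply/existsP; apply: contraNT Qe; rewrite negb_exists => /forallP Q0'.
  by apply/eqP/row_matrixP => i; apply/eqP; rewrite row0; apply/negPn/Q0'.
by exists (row i (map_mx (coefp e) Q)) => // u uL; rewrite -row_mul Qu.
Qed.

End RationalRepresentation.

(** * Elimination towards the big cell *)

Section BigCell.

Variables (F : fieldType) (n : nat).
Local Notation J := (witt_gram F n).
Local Notation flip := (flip_mx F n).
Implicit Types (g : 'M[F]_(n + n)) (A B L : 'M[F]_n).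

Lemma Sp_tr g : Sp g -> Sp g^T.
Proof. by move=> gS; rewrite /Sp trmxK Sp_gram_tr. Qed.

Lemma Sp_lower_tr g : Sp_lower g -> Sp_unipotent g^T.
Proof.
by move=> [gS gL]; split; [exact: Sp_tr|move=> i j ij; rewrite mxE gL // eq_sym].
Qed.

Lemma Sp_lower_block (c : 'M[F]_n) :
  c^T *m flip = flip *m c -> Sp_lower (block_mx 1%:M 0 c 1%:M).
Proof.
move=> cJ; split.
  rewrite /Sp witt_gramE tr_block_mx !mulmx_block !trmx0 !trmx1.
  rewrite !(mul0mx, mulmx0, mul1mx, mulmx1, addr0, add0r).
  by rewrite mulmxN cJ addNr.
move=> i j; case: (split_ordP i) => r ->; case: (split_ordP j) => s -> rs.
- by rewrite block_mxEul mxE eq_lshift.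
- by rewrite block_mxEur mxE eq_lrshift.
- by move: rs; rewrite /= leqNgt (leq_trans (ltn_ord s) (leq_addr _ _)).
- by rewrite block_mxEdr mxE eq_rshift.
Qed.

(** The elimination matrix [1 - x e_j^T] of [GL_n], placed in the Levi subgroup. As [x] vanishes at
    [j], its inverse transpose is [1 + e_j x^T]. *)
Lemma Sp_lower_block_diag (x : 'cV[F]_n) (j : 'I_n) :
  (forall i : 'I_n, (i <= j)%N -> x i 0 = 0) ->
  Sp_lower (block_mx (1%:M - x *m delta_mx 0 j) 0 0
                     (flip *m (1%:M + (delta_mx j 0 : 'cV_n) *m x^T) *m flip)).
Proof.
move=> xj; split.
  apply: Sp_block_diag; rewrite raddfB /= trmx1 trmx_mul trmx_delta !mulmxA.
  rewrite -(mulmxA _ flip flip) flip_mxK mulmx1 -[RHS]mul1mx; congr (_ *m _).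
  set e : 'cV[F]_n := delta_mx j 0.
  have xe : x^T *m e = 0 by rewrite -colE; apply/matrixP => r s; rewrite !mxE ord1 xj.
  have ee : e *m x^T *m (e *m x^T) = 0 by rewrite mulmxA -(mulmxA e) xe mulmx0 mul0mx.
  by rewrite mulmxDr mulmx1 mulmxBl mul1mx ee subr0 subrK.
move=> i k; case: (split_ordP i) => r ->; case: (split_ordP k) => s -> rs.
- rewrite block_mxEul eq_lshift !mxE big_ord1 !mxE eqxx /=.
  case: (eqVneq s j) => [sj|_]; last by rewrite mulr0 subr0.
  by rewrite xj ?mul0r ?subr0 // -sj.
- by rewrite block_mxEur mxE eq_lrshift.
- by move: rs; rewrite /= leqNgt (leq_trans (ltn_ord s) (leq_addr _ _)).
rewrite block_mxEdr eq_rshift mul_flip flip_mul !mxE big_ord1 !mxE eqxx andbT.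
rewrite (inj_eq rev_ord_inj); case: (eqVneq (rev_ord r) j) => [rj|_]; last first.
  by rewrite mul0r addr0.
rewrite xj ?mulr0 ?addr0 // -rj /= leq_sub2l // ltnS.
by move: rs; rewrite /= leq_add2l.
Qed.

Lemma lead_minor_tr (i : 'I_n) A : lead_minor i A^T = lead_minor i A.
Proof.
rewrite /lead_minor -[LHS]det_tr; congr (\det _).
by apply/matrixP => r s; rewrite !mxE.
Qed.

(** The leading rows of [L *m A] only involve the leading rows of [A], through a unitriangular block
    of [L]. *)
Lemma lead_minor_lower_mul (i : 'I_n) L A :
  (forall r s : 'I_n, (r <= s)%N -> L r s = (r == s)%:R) ->
  lead_minor i (L *m A) = lead_minor i A.
Proof.
move=> LL; rewrite /lead_minor; set w := widen_ord _.
have -> : mxsub w w (L *m A) = mxsub w w L *m mxsub w w A.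
  apply/matrixP => r s; rewrite !mxE.
  rewrite (bigID (fun l : 'I_n => l < i.+1)%N) /= [X in _ + X]big1 ?addr0 => [|l].
    rewrite (big_ord_narrow (ltn_ord i)); apply: eq_bigr => l _.
    by rewrite !mxE.
  rewrite -leqNgt => il; rewrite LL; last exact: ltnW (leq_trans (ltn_ord r) il).
  by rewrite -val_eqE /= ltn_eqF ?mul0r // (leq_trans (ltn_ord r) il).
rewrite det_mulmx det_trig.
  by rewrite big1 ?mul1r // => r _; rewrite mxE LL // eqxx.
apply/is_trig_mxP => r s rs; rewrite mxE LL ?(ltnW rs) //.
by rewrite -val_eqE /= ltn_eqF.
Qed.

(** The invariant of the elimination: [B] is block diagonal, and its leading block of size [j] is
    diagonal. *)
Definition cleared (j : nat) B : Prop :=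
  forall r s : 'I_n, r != s -> ((r < j) || (s < j))%N -> B r s = 0.

Lemma cleared_tr j B : cleared j B -> cleared j B^T.
Proof. by move=> cB r s rs; rewrite mxE orbC => /cB -> //; rewrite eq_sym. Qed.

Lemma cleared_diag_neq0 (j : 'I_n) B : cleared j B -> lead_minor j B != 0 -> B j j != 0.
Proof.
move=> cB; rewrite /lead_minor det_trig; last first.
  apply/is_trig_mxP => r s rs; rewrite mxE cB //.
    by rewrite -val_eqE /= ltn_eqF.
  by rewrite (leq_trans rs) // -ltnS.
rewrite big_ord_recr mulf_eq0 negb_or => /andP[_]; rewrite mxE.
by congr (B _ _ != 0); apply: val_inj.
Qed.

(** One Gaussian step with pivot [B j j]: the entries below it are cleared, while the rows up to [j]
    are unchanged. *)
Lemma clear_column (j : 'I_n) g : Sp g -> cleared j (ulsubmx g) ->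
  ulsubmx g j j != 0 ->
  exists2 l, Sp_lower l &
    [/\ forall r : 'I_n, (j < r)%N -> ulsubmx (l *m g) r j = 0,
        forall s, ulsubmx (l *m g) j s = ulsubmx g j s,
        cleared j (ulsubmx (l *m g))
      & forall i, lead_minor i (ulsubmx (l *m g)) = lead_minor i (ulsubmx g)].
Proof.
move=> gS cB Bj; set B := ulsubmx g in cB Bj *.
pose x : 'cV[F]_n := \col_r (if (j < r)%N then B r j / B j j else 0).
have xj (i : 'I_n) : (i <= j)%N -> x i 0 = 0 by rewrite mxE ltnNge => ->.
have lL := Sp_lower_block_diag xj.
exists (block_mx (1%:M - x *m delta_mx 0 j) 0 0
                 (flip *m (1%:M + (delta_mx j 0 : 'cV_n) *m x^T) *m flip)) => //.
have -> : ulsubmx (block_mx (1%:M - x *m delta_mx 0 j) 0 0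
    (flip *m (1%:M + (delta_mx j 0 : 'cV_n) *m x^T) *m flip) *m g)
    = (1%:M - x *m delta_mx 0 j) *m B.
  by rewrite -[g in LHS]submxK mulmx_block block_mxKul mul0mx addr0.
have BE r s : ((1%:M - x *m delta_mx 0 j) *m B) r s = B r s - x r 0 * B j s.
  rewrite mulmxBl mul1mx -mulmxA -rowE [LHS]mxE [X in _ + X]mxE; congr (_ - _).
  by rewrite mxE big_ord1 [row _ _ _ _]mxE.
have xj0 : x j 0 = 0 by rewrite xj.
split.
- by move=> r jr; rewrite BE [x r 0]mxE jr divfK ?subrr.
- by move=> s; rewrite BE xj0 mul0r subr0.
- move=> r s rs; rewrite BE => rsj; rewrite cB // sub0r.
  have [rj|jr] := leqP r j; first by rewrite xj // mul0r oppr0.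
  move: rsj; rewrite ltnNge (ltnW jr) /= => sj.
  by rewrite cB ?sj ?orbT ?mulr0 ?oppr0 // -val_eqE gtn_eqF.
move=> i; apply: lead_minor_lower_mul => r s rs.
have [_ /(_ (lshift n r) (lshift n s) rs)] := lL.
by rewrite block_mxEul eq_lshift.
Qed.

(** Left multiplication by the lower block matrix with corner [- c a^-1], which is symplectic
    because [c^T flip a = a^T flip c]. *)
Lemma clear_blocks g : Sp g -> ulsubmx g \in unitmx ->
  exists2 l, Sp_lower l &
    [/\ ulsubmx (l *m g) = ulsubmx g, ursubmx (l *m g) = ursubmx g
      & dlsubmx (l *m g) = 0].
Proof.
move=> gS; rewrite -[g]submxK block_mxKul block_mxKur.
set a := ulsubmx g; set b := ursubmx g; set c := dlsubmx g; set e := drsubmx g => aU.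
have ca : c^T *m flip *m a = a^T *m flip *m c.
  move: gS; rewrite -[g]submxK -/a -/b -/c -/e /Sp witt_gramE tr_block_mx !mulmx_block.
  rewrite !(mulmx0, addr0, add0r) => /eq_block_mx[/eqP + _ _ _].
  by rewrite mulmxN mulNmx addrC subr_eq0 => /eqP ->.
exists (block_mx 1%:M 0 (- (c *m invmx a)) 1%:M).
  apply: Sp_lower_block; rewrite raddfN /= mulNmx mulmxN; congr (- _).
  apply: (can_inj (mulmxK aU)).
  rewrite trmx_mul trmx_inv -!mulmxA mulVmx // mulmx1 (mulmxA c^T) ca.
  by rewrite -mulmxA mulKmx ?unitmx_tr.
rewrite mulmx_block block_mxKul block_mxKur block_mxKdl.
by rewrite !mul1mx !mul0mx !addr0 mulNmx -mulmxA mulVmx // mulmx1 addNr.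
Qed.

Lemma lead_minor_diag (i : 'I_n) (t : 'rV[F]_n) :
  lead_minor i (diag_mx t) = fundamental_weight i t.
Proof.
rewrite /lead_minor det_trig; last first.
  by apply/is_trig_mxP => r s rs; rewrite !mxE -val_eqE /= ltn_eqF.
rewrite /fundamental_weight (big_ord_narrow (ltn_ord i)).
by apply: eq_bigr => r _; rewrite !mxE eqxx.
Qed.

End BigCell.

(** A subspace inside [Q] is enlarged, by excluded middle, until it exhausts [Q]; the codimension
    bounds the number of steps. *)
Lemma subspace_of_pred (F : fieldType) (V : vectType F) (Q : V -> Prop) :
  Q 0 -> (forall c x y, Q x -> Q y -> Q (c *: x + y)) ->
  exists W : {vspace V}, forall x, x \in W <-> Q x.
Proof.
move=> Q0 QL.
suff H : forall m (W : {vspace V}), (forall x, x \in W -> Q x) ->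
    (\dim (fullv : {vspace V}) - \dim W <= m)%N ->
    exists W' : {vspace V}, forall x, x \in W' <-> Q x.
  apply: (H (\dim (fullv : {vspace V})) 0%VS); last exact: leq_subr.
  by move=> x; rewrite memv0 => /eqP ->.
elim=> [|m IH] W WQ Wm.
  exists W => x; split; first exact: WQ.
  move: Wm; rewrite leqn0 subn_eq0 => Wm _.
  suff -> : W = fullv by rewrite memvf.
  by apply/eqP; rewrite eqEdim subvf.
have [[x [Qx xW]]|no] := classic (exists x, Q x /\ x \notin W); last first.
  exists W => x; split; first exact: WQ.
  by move=> Qx; case: (boolP (x \in W)) => // xW; case: no; exists x.
apply: (IH (W + <[x]>)%VS).
  move=> y /memv_addP[w /WQ Qw [_ /vlineP[c ->] ->]].
  by rewrite addrC; apply: QL.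
have lt : (\dim W < \dim (W + <[x]>))%N.
  rewrite ltn_neqAle dimvS ?addvSl // andbT; apply: contraNneq xW => dW.
  have /eqP -> : W == (W + <[x]>)%VS by rewrite eqEdim addvSl dW /=.
  by rewrite memvE addvSr.
have le : (\dim (W + <[x]>)%VS <= \dim (fullv : {vspace V}))%N by rewrite dimvS ?subvf.
by rewrite -ltnS (leq_trans _ Wm) // ltn_sub2l // (leq_trans lt).
Qed.

(** * The matrix coefficient of the highest weight vector *)

Section HighestWeightCoefficient.

Variables (F : closedFieldType) (n d : nat).
Variable rho : 'M[F]_(n + n) -> 'M[F]_d.
Hypothesis hrho : rational_representation rho.
Hypothesis hirr : irreducible_representation rho.
Variables (a : 'I_n -> nat) (v : 'cV[F]_d) (f : 'rV[F]_d).
Hypotheses (v0 : v != 0) (f0 : f != 0)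
  (vU : forall u, Sp_unipotent u -> rho u *m v = v)
  (vT : forall t : 'rV[F]_n, (forall i, t 0 i != 0) ->
     rho (torus_elt t) *m v = weight a t *: v)
  (fL : forall u, Sp_lower u -> f *m rho u = f).

Definition coefficient (g : 'M[F]_(n + n)) : F := (f *m rho g *m v) 0 0.

Definition Sp_poly (g : 'M[F]_(n + n)) : F := highest_weight_poly a (ulsubmx g).

Lemma coefficient_lower l g : Sp_lower l -> Sp g -> coefficient (l *m g) = coefficient g.
Proof. by move=> lL gS; rewrite /coefficient (rhoM hrho lL.1 gS) mulmxA fL. Qed.

Lemma coefficient_upper l g : Sp_lower l -> Sp g -> coefficient (g *m l^T) = coefficient g.
Proof.
move=> lL gS; have lS := Sp_tr lL.1.
by rewrite /coefficient (rhoM hrho gS lS) mulmxA -[_ *m v]mulmxA vU //; apply: Sp_lower_tr.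
Qed.

Lemma ulsubmx_tr (g : 'M[F]_(n + n)) : ulsubmx g^T = (ulsubmx g)^T.
Proof. by rewrite trmx_ulsub. Qed.

Lemma highest_weight_poly_diag (t : 'rV[F]_n) :
  highest_weight_poly a (diag_mx t) = weight a t.
Proof. by apply: eq_bigr => i _; rewrite lead_minor_diag. Qed.

Lemma coefficient_torus (t : 'rV[F]_n) : (forall i, t 0 i != 0) ->
  coefficient (torus_elt t) = weight a t * coefficient 1%:M.
Proof.
move=> t0; rewrite /coefficient -mulmxA vT // (rho1 hrho) mulmx1 -scalemxAr.
by rewrite mxE.
Qed.

(** The lower left block is cleared, then the upper right one after transposition. A block diagonal
    symplectic matrix is determined by its first block, so a torus element remains. *)
Lemma coefficient_diag g : Sp g -> is_diag_mx (ulsubmx g) ->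
  (forall i, ulsubmx g i i != 0) -> coefficient g = Sp_poly g * coefficient 1%:M.
Proof.
move=> gS /diag_mxP[t tE]; rewrite /Sp_poly tE => g0.
have t0 i : t 0 i != 0 by have := g0 i; rewrite mxE eqxx.
have tU : diag_mx t \in unitmx.
  by rewrite unitmxE det_diag unitfE; apply/prodf_neq0.
have [|l lL [lul lur ldl]] := clear_blocks gS; first by rewrite tE.
have lgS := SpM lL.1 gS.
have [|l' lL' [lul' lur' ldl']] := clear_blocks (Sp_tr lgS).
  by rewrite ulsubmx_tr lul tE unitmx_tr.
have gS' := SpM lL'.1 (Sp_tr lgS).
have gTS' := Sp_tr gS'.
have -> : coefficient g = coefficient (l' *m (l *m g)^T)^T.
  by rewrite trmx_mul trmxK coefficient_upper // coefficient_lower.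
set h := (_ *m _)^T in gTS' *.
have hE : h = block_mx (diag_mx t) 0 0 (drsubmx h).
  rewrite -[LHS]submxK; congr block_mx.
  - by rewrite /h ulsubmx_tr lul' ulsubmx_tr trmxK lul.
  - by rewrite /h -trmx_dlsub ldl' trmx0.
  - by rewrite /h -trmx_ursub lur' -trmx_dlsub ldl !trmx0.
have blk (e : 'M[F]_n) : Sp (block_mx (diag_mx t) 0 0 e) ->
    e = invmx (diag_mx t *m flip_mx F n) *m flip_mx F n.
  rewrite /Sp witt_gramE tr_block_mx !mulmx_block !trmx0 tr_diag_mx.
  rewrite !(mul0mx, mulmx0, addr0, add0r) => /eq_block_mx[_ E _ _].
  rewrite -{2}E mulKmx // unitmx_mul tU /=.
  by case: (mulmx1_unit (flip_mxK F n)).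
have hT : h = torus_elt t.
  rewrite hE (blk (drsubmx h)) -?hE //.
  have tS := torus_elt_Sp t0; rewrite torus_eltE in tS *.
  by rewrite (blk _ tS).
by rewrite hT coefficient_torus // highest_weight_poly_diag.
Qed.

(** Induction on the number [m] of columns still to be cleared. Column [j] is cleared from the left
    and row [j] after transposition; this changes neither the coefficient nor the leading minors. *)
Lemma coefficient_big_cell g : Sp g -> (forall i, lead_minor i (ulsubmx g) != 0) ->
  coefficient g = Sp_poly g * coefficient 1%:M.
Proof.
suff H : forall m g, Sp g -> (forall i, lead_minor i (ulsubmx g) != 0) ->
    cleared (n - m) (ulsubmx g) -> coefficient g = Sp_poly g * coefficient 1%:M.
  by move=> gS g0; apply: (H n) => // r s _; rewrite subnn.
move=> {g}; elim=> [|m IH] g gS g0 cg.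
  apply: coefficient_diag => //.
    apply/is_diag_mxP => r s rs; apply: cg; first by rewrite -val_eqE.
    by rewrite subn0 ltn_ord.
  move=> i; apply: (cleared_diag_neq0 (j := i)) => // r s rs _.
  by apply: cg => //; rewrite subn0 ltn_ord.
(* By truncated subtraction nothing is cleared yet in this case, at [m] as at [m.+1]. *)
have [nm|mn] := leqP n m.
  by apply: IH => // r s rs; move: nm; rewrite -subn_eq0 => /eqP ->.
have jn : (n - m.+1 < n)%N by rewrite ltn_subrL (leq_trans _ mn).
pose j := Ordinal jn.
have jS : (n - m = j.+1)%N by rewrite /= -subSn.
have cj : cleared j (ulsubmx g) by [].
have [l lL [lj _ lc lm]] := clear_column gS cj (cleared_diag_neq0 cj (g0 j)).
have lgS := SpM lL.1 gS.
have ct : cleared j (ulsubmx (l *m g)^T) by rewrite ulsubmx_tr; apply: cleared_tr.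
have j0 : ulsubmx (l *m g)^T j j != 0.
  apply: cleared_diag_neq0 => //.
  by rewrite ulsubmx_tr lead_minor_tr lm.
have [l' lL' [lj' lr' lc' lm']] := clear_column (Sp_tr lgS) ct j0.
set h := l' *m _ in lj' lr' lc' lm'.
have hS : Sp h := SpM lL'.1 (Sp_tr lgS).
have mE i : lead_minor i (ulsubmx h^T) = lead_minor i (ulsubmx g).
  by rewrite ulsubmx_tr lead_minor_tr lm' ulsubmx_tr lead_minor_tr lm.
have -> : coefficient g = coefficient h^T.
  by rewrite trmx_mul trmxK coefficient_upper // coefficient_lower.
have -> : Sp_poly g = Sp_poly h^T by apply: eq_bigr => i _; rewrite mE.
apply: IH => [|i|]; [exact: Sp_tr|by rewrite mE|].
rewrite ulsubmx_tr; apply: cleared_tr => r s rs.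
rewrite jS !ltnS [(r <= j)%N]leq_eqVlt [(s <= j)%N]leq_eqVlt.
have [|/norP[rj sj]] := boolP ((r < j) || (s < j))%N; first by move=> rsj _; apply: lc'.
rewrite (negPf rj) (negPf sj) !orbF => /orP[/eqP /val_inj rE|/eqP /val_inj sE].
  rewrite rE lr' ulsubmx_tr mxE lj // -rE.
  by rewrite ltn_neqAle eq_sym val_eqE eq_sym rs rE leqNgt.
by rewrite sE lj' // ltn_neqAle -sE val_eqE eq_sym rs sE leqNgt.
Qed.

Lemma polyfun_coefficient (g : F -> 'M[F]_(n + n)) :
  (forall z, Sp (g z)) -> polymx g -> polyfun (fun z => coefficient (g z)).
Proof.
move=> gS pg; have [P PE] := polymx_rho hrho.
apply: (@polyfun_ext _ (fun z =>
   (f *m (\matrix_(i, j) (P i j).@[fun l => mxvec (g z) 0 l]) *m v) 0 0)).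
  by move=> z; rewrite /coefficient (PE _ (gS z)).
apply: (@polymxM _ _ _ _ (fun z => f *m _) (fun=> v)); last exact: polymx_cst.
apply: polymxM; first exact: polymx_cst.
move=> i j; apply: (@polyfun_ext _ (fun z => (P i j).@[fun l => mxvec (g z) 0 l])).
  by move=> z; rewrite mxE.
apply: polyfun_meval => l; case/mxvec_indexP: l => r s.
by apply: polyfun_ext (pg r s) => z; rewrite mxvecE.
Qed.

(* A product of transvections lies on a polynomial curve through 1, which meets the
   big cell in all but finitely many points. *)
Lemma coefficientE g : Sp g -> coefficient g = Sp_poly g * coefficient 1%:M.
Proof.
move=> gS; have [l lE] := Sp_transvections gS.
have pl := polymx_transvections l; have lS z := transvections_Sp l z.
have pul : polymx (fun z => ulsubmx (transvections l z)).
  by move=> i j; apply: polyfun_ext (pl _ _) => z; rewrite !mxE.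
rewrite -lE; apply/eqP; rewrite -subr_eq0; apply/eqP.
pose D z := \prod_i lead_minor i (ulsubmx (transvections l z)).
apply: (polyfun_eq0 (f := fun z => coefficient (transvections l z)
    - Sp_poly (transvections l z) * coefficient 1%:M) (g := D)).
- apply: polyfunD; first exact: polyfun_coefficient.
  apply/polyfunN/polyfunM; last exact: polyfun_cst.
  exact: polyfun_highest_weight_poly.
- by apply: polyfun_prod => i _; apply: polyfun_lead_minor.
- exists 0; apply/prodf_neq0 => i _; rewrite transvections0.
  rewrite scalar_mx_block block_mxKul -diag_const_mx lead_minor_diag.
  by apply/prodf_neq0 => r _; rewrite mxE oner_neq0.
move=> z /prodf_neq0 Dz; rewrite coefficient_big_cell ?subrr // => i.
exact: Dz.
Qed.

Lemma stable_pred_full (Q : 'cV[F]_d -> Prop) :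
  Q 0 -> (forall c x y, Q x -> Q y -> Q (c *: x + y)) ->
  (forall g x, Sp g -> Q x -> Q (rho g *m x)) ->
  (exists x, Q x /\ x != 0) -> forall x, Q x.
Proof.
move=> Q0 QL Qg [x [Qx x0]]; have [W WQ] := subspace_of_pred Q0 QL.
have [|W0|Wf] := hirr.2 W; last by move=> y; apply/WQ; rewrite Wf memvf.
  by move=> g gS y /WQ Qy; apply/WQ/Qg.
by move/WQ: Qx; rewrite W0 memv0 (negPf x0).
Qed.

(** By irreducibility the vectors [rho h *m v] span, so [f *m rho g] kills the image of [X]. The
    translates of a non-zero column of [X] would span too, forcing [f = 0]. *)
Lemma mx_pairing0 (X : 'M[F]_d) :
  (forall g h, Sp g -> Sp h -> (f *m rho g *m X *m rho h *m v) 0 0 = 0) -> X = 0.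
Proof.
move=> X0; apply/matrixP => i j; rewrite [RHS]mxE.
have lin (y : 'rV[F]_d) c (x1 x2 : 'cV[F]_d) : (y *m (c *: x1 + x2)) 0 0
    = c * (y *m x1) 0 0 + (y *m x2) 0 0 by rewrite mulmxDr -scalemxAr !mxE.
have fX g (x : 'cV[F]_d) : Sp g -> (f *m rho g *m X *m x) 0 0 = 0.
  move=> gS; pose Q (x : 'cV[F]_d) := forall h, Sp h -> (f *m rho g *m X *m (rho h *m x)) 0 0 = 0.
  suff : Q x by move/(_ _ (Sp1 F n)); rewrite (rho1 hrho) mul1mx.
  apply: stable_pred_full => [h _|c x1 x2 Q1 Q2 h hS|h y hS Qy h' hS'|].
  - by rewrite !mulmx0 mxE.
  - by rewrite mulmxDr -scalemxAr lin Q1 // Q2 // mulr0 addr0.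
  - by rewrite (mulmxA (rho h')) -(rhoM hrho hS' hS); apply/Qy/SpM.
  - by exists v; split=> // h hS; rewrite mulmxA X0.
pose Q (x : 'cV[F]_d) := forall h, Sp h -> (f *m rho h *m x) 0 0 = 0.
have Qj : Q (col j X) by move=> h hS; rewrite colE mulmxA fX.
have [X0'|Xj] := eqVneq (col j X) 0.
  by have /matrixP/(_ i 0) := X0'; rewrite !mxE.
suff f00 : f = 0 by case/eqP: f0.
have Qall x : Q x.
  apply: stable_pred_full => [h _|c x1 x2 Q1 Q2 h hS|h y hS Qy h' hS'|].
  - by rewrite mulmx0 mxE.
  - by rewrite lin Q1 // Q2 // mulr0 addr0.
  - by rewrite -mulmxA (mulmxA (rho h')) -(rhoM hrho hS' hS) mulmxA; apply/Qy/SpM.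
  - by exists (col j X).
apply/matrixP => r s; rewrite ord1 [RHS]mxE.
have := Qall (delta_mx s 0) _ (Sp1 F n); rewrite (rho1 hrho) mulmx1 -colE => <-.
by rewrite mxE.
Qed.

Lemma coefficient1_neq0 : coefficient 1%:M != 0.
Proof.
apply/negP => /eqP c0.
suff : (1%:M : 'M[F]_d) = 0.
  move=> /matrixP/(_ _ _) E; case/eqP: v0; apply/matrixP => i j.
  by rewrite -[v]mul1mx !mxE big1 // => r _; rewrite E mxE mul0r.
apply: mx_pairing0 => g h gS hS.
rewrite mulmx1 -(mulmxA f) -(rhoM hrho gS hS) -/(coefficient _).
by rewrite coefficientE ?c0 ?mulr0 //; apply: SpM.
Qed.

End HighestWeightCoefficient.

(** * Composition factors and orthogonal decompositions *)

Section Decomposition.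

Variables (F : fieldType) (n k : nat) (ns : 'I_k -> nat).
Variable U : 'I_k -> {vspace 'cV[F]_(n + n)}.
Hypothesis hU : orthogonal_decomposition ns U.
Implicit Types (g h : 'M[F]_(n + n)) (u w : 'cV[F]_(n + n)).

Lemma decompose w :
  exists2 W : 'I_k -> 'cV[F]_(n + n), forall i, W i \in U i & w = \sum_i W i.
Proof.
have : w \in (\sum_(i < k) U i)%VS by rewrite (od_span hU) memvf.
by move=> /memv_sumP[W WU ->]; exists W => // i; apply: WU.
Qed.

(** The image of [h - 1] lies in [U j], where [g] is the identity. *)
Lemma Sp_factor_sub_mul i j g h : i != j -> Sp_factor U i g -> Sp_factor U j h ->
  (g - 1%:M) *m (h - 1%:M) = 0.
Proof.
move=> ij [_ _ gU] [_ hUj hU'].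
apply/trmx_inj/row_matrixP => r; rewrite -!tr_col; congr _^T.
rewrite colE -mulmxA [RHS]colE mul0mx.
have [W WU ->] := decompose (delta_mx r 0).
rewrite mulmx_sumr (bigD1 j) //= big1 ?addr0 => [|l lj]; last first.
  by rewrite mulmxBl mul1mx (hU' _ lj _ (WU l)) subrr.
have hW : (h - 1%:M) *m W j \in U j by rewrite mulmxBl mul1mx rpredB ?hUj.
by rewrite mulmxBl mul1mx (gU j _ _ hW) ?subrr // eq_sym.
Qed.

Lemma Sp_factor_Sp i g : Sp_factor U i g -> Sp g.
Proof. by case. Qed.

Lemma Sp_factor_stable i j g u : Sp_factor U i g -> u \in U j -> g *m u \in U j.
Proof.
move=> [_ gUi gUj]; have [->|ji] := eqVneq j i; first exact: gUi.
by move=> uj; rewrite (gUj j).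
Qed.

Lemma Sp_factor1 i : Sp_factor U i 1%:M.
Proof. by split=> [|u|j _ u]; rewrite ?mul1mx //; apply: Sp1. Qed.

Lemma Sp_factor_product i g : Sp_factor U i g -> Sp_product U g.
Proof.
move=> gi; exists (fun j => if j == i then g else 1%:M).
  by move=> j; case: eqP => [->|_] //; apply: Sp_factor1.
by rewrite -big_mkcond big_pred1_eq.
Qed.

Lemma Sp_product_Sp g : Sp_product U g -> Sp g.
Proof.
move=> [h hH ->]; elim/big_ind: _ => [|x y|i _]; first exact: Sp1.
  exact: SpM.
exact: Sp_factor_Sp (hH i).
Qed.

Lemma Sp_product_stable j g u : Sp_product U g -> u \in U j -> g *m u \in U j.
Proof.
move=> [h hH ->]; elim/big_ind: _ u => [u|x y IHx IHy u|i _ u].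
- by rewrite mul1mx.
- by move=> uj; rewrite -mulmxA; apply/IHx/IHy.
exact: Sp_factor_stable (hH i).
Qed.

(** For [i != j] the component of [w] in [U i] is orthogonal to [U i], hence zero by
    non-degeneracy. *)
Lemma orthogonal_mem j w :
  (forall i u, i != j -> u \in U i -> sform w u = 0) -> w \in U j.
Proof.
have [W WU ->] := decompose w; move=> w0.
rewrite (bigD1 j) //= big1 ?addr0 // => i ij.
apply: (od_nondegenerate hU (WU i)) => u ui.
have := w0 i u ij ui; rewrite sformC sform_sumr (bigD1 i) //= big1 => [|l li].
  by rewrite addr0 -sformC.
by apply: (od_orthogonal hU _ ui (WU l)); rewrite eq_sym.
Qed.

Lemma Sp_product_stable_inv j g u : Sp_product U g -> u \in U j -> spinv g *m u \in U j.
Proof.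
move=> gP uj; apply: orthogonal_mem => i w ij wi.
rewrite (sform_inv _ _ (Sp_product_Sp gP)).
apply: (od_orthogonal hU _ uj (Sp_product_stable gP wi)).
by rewrite eq_sym.
Qed.

(** Normality of [H_i], which makes the spaces of [H_i]-fixed vectors stable under the whole
    product. *)
Lemma Sp_factor_conj i g h : Sp_product U g -> Sp_factor U i h ->
  Sp_factor U i (spinv g *m h *m g).
Proof.
move=> gP [hS hUi hUj]; have gS := Sp_product_Sp gP.
split=> [|u ui|j ji u uj]; first by apply/SpM/gS/SpM/hS/Sp_inv.
  by rewrite -!mulmxA; apply/Sp_product_stable_inv/hUi/Sp_product_stable.
rewrite -!mulmxA (hUj j) //; last exact: Sp_product_stable.
by rewrite mulmxA spinvK // mul1mx.
Qed.

End Decomposition.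

Section DifferenceOperators.

Variables (F : fieldType) (n d : nat) (rho : 'M[F]_(n + n) -> 'M[F]_d).

Definition difference_operator (hs : seq 'M[F]_(n + n)) : 'M[F]_d :=
  foldr (fun h X => (rho h - 1%:M) *m X) 1%:M hs.

Lemma difference_operator_mem (W : {vspace 'cV[F]_d}) hs w :
  {in hs, forall h, forall u, u \in W -> rho h *m u \in W} ->
  w \in W -> difference_operator hs *m w \in W.
Proof.
elim: hs => [|h hs IH] hW wW /=; first by rewrite mul1mx.
rewrite -mulmxA mulmxBl mul1mx rpredB //; last first.
  by apply: IH => // x xhs; apply: hW; rewrite inE xhs orbT.
apply: (hW h); first exact: mem_head.
by apply: IH => // x xhs; apply: hW; rewrite inE xhs orbT.
Qed.

End DifferenceOperators.

(** * Products of differences on composition factors *)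

Section Vanishing.

Variables (F : closedFieldType) (n k d : nat) (ns : 'I_k -> nat).
Variable U : 'I_k -> {vspace 'cV[F]_(n + n)}.
Hypothesis hU : orthogonal_decomposition ns U.
Variable rho : 'M[F]_(n + n) -> 'M[F]_d.
Hypothesis hrho : rational_representation rho.

(* The vectors of [W] fixed by [H_i] modulo [W'] form a submodule, which is [W']
   unless [H_i] acts trivially; hence the difference operators can be stripped off
   one at a time. *)
Lemma acts_trivially_of_vanishing (W' W : {vspace 'cV[F]_d}) :
  composition_factor rho (Sp_product U) W' W ->
  (forall h : 'I_k -> 'M[F]_(n + n), (forall i, Sp_factor U i (h i)) ->
     difference_operator rho [seq h i | i <- enum 'I_k] = 0) ->
  exists i, acts_trivially rho (Sp_factor U i) W' W.
Proof.
move=> [m [c [j [cs jm -> ->]]]] {W' W} D0; set W' := c j; set W := c j.+1.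
have W'S : stable rho (Sp_product U) W' := cs_stable cs (ltnW jm).
have WS : stable rho (Sp_product U) W := cs_stable cs jm.
have [W'W W'nW Wsimple] : simple_quotient rho (Sp_product U) W' W := cs_simple cs jm.
apply: NNPP => no.
have fixed i w : w \in W ->
    (forall h, Sp_factor U i h -> rho h *m w - w \in W') -> w \in W'.
  move=> wW wfix.
  have [X XE] : exists X : {vspace 'cV[F]_d}, forall x, x \in X <->
      (x \in W /\ forall h, Sp_factor U i h -> rho h *m x - x \in W').
    apply: subspace_of_pred => [|b x y [xW xh] [yW yh]].
      by split=> [|h _]; rewrite ?mulmx0 ?subr0 mem0v.
    split=> [|h hi]; first by rewrite rpredD // rpredZ.
    rewrite mulmxDr -scalemxAr opprD addrACA -scalerBr.
    by rewrite rpredD ?yh // rpredZ // xh.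
  have XS : stable rho (Sp_product U) X.
    move=> g gP x /XE[xW xh]; apply/XE; split=> [|h hi]; first exact: WS.
    have gS := Sp_product_Sp gP; have [hS _ _] := hi.
    have ci := Sp_factor_conj hU gP hi; have [cS _ _] := ci.
    have -> : rho h *m (rho g *m x) - rho g *m x
            = rho g *m (rho (spinv g *m h *m g) *m x - x).
      rewrite mulmxBr !mulmxA -(rhoM hrho hS gS) -(rhoM hrho gS cS).
      by rewrite !mulmxA spinvKr // mul1mx.
    by apply: W'S => //; apply: xh.
  have W'X : (W' <= X)%VS.
    apply/subvP => x xW'; apply/XE; split; first exact: subvP W'W _ xW'.
    move=> h hi; rewrite rpredB //.
    by apply: (W'S h) => //; apply: Sp_factor_product hi.
  have XW : (X <= W)%VS by apply/subvP => x /XE[].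
  have [XW'|XW''] := Wsimple X XS W'X XW; first by rewrite -XW'; apply/XE.
  case: no; exists i => h hi x xW.
  have xX : x \in X by rewrite XW''.
  by have /XE[_ xh] := xX; apply: xh.
have main s : uniq s -> forall w, w \in W ->
    (forall h, (forall i, Sp_factor U i (h i)) ->
       difference_operator rho [seq h i | i <- s] *m w \in W') -> w \in W'.
  elim: s => [|i s IH] /=.
    by move=> _ w _ /(_ (fun=> 1%:M) (Sp_factor1 U)); rewrite mul1mx.
  move=> /andP[is_ us] w wW wh; apply: IH => // h hH.
  apply: (fixed i) => [|h0 h0i].
    apply: difference_operator_mem => // _ /mapP[l _ ->] u uW.
    by apply: (WS (h l)) => //; apply: Sp_factor_product (hH l).
  (* As [i] does not occur in [s], the element [h i] may be changed without affecting the other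
     factors. *)
  have := wh (fun l => if l == i then h0 else h l).
  rewrite eqxx -mulmxA mulmxBl mul1mx.
  have -> : [seq (if l == i then h0 else h l) | l <- s] = map h s.
    by apply/eq_in_map => l ls; case: eqP => // li; rewrite -li ls in is_.
  by apply=> l; case: eqP => [->|].
case/eqP: W'nW; apply/eqP; rewrite eqEsubv W'W; apply/subvP => w wW.
apply: (main _ (enum_uniq 'I_k)) => // h hH.
by rewrite D0 // mul0mx mem0v.
Qed.

Section Irreducible.

Hypothesis hirr : irreducible_representation rho.
Variables (a : 'I_n -> nat) (v : 'cV[F]_d) (f : 'rV[F]_d).
Hypotheses (v0 : v != 0) (f0 : f != 0)
  (vU : forall u, Sp_unipotent u -> rho u *m v = v)
  (vT : forall t : 'rV[F]_n, (forall i, t 0 i != 0) ->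
     rho (torus_elt t) *m v = weight a t *: v)
  (fL : forall u, Sp_lower u -> f *m rho u = f).

Lemma ulsubmxD : {morph (fun g : 'M[F]_(n + n) => ulsubmx g) : g h / g + h}.
Proof. by move=> g h; apply/matrixP => i j; rewrite !mxE. Qed.

(* As [(x - 1) (y - 1) = 0], translating along [g (x - 1) h] does not change the
   direction [g (y - 1) h]. *)
Lemma coefficient_nabla (I : eqType) (h : I -> 'M[F]_(n + n)) (s : seq I) g g' :
  uniq s -> (forall i, Sp (h i)) ->
  (forall i j, i != j -> (h i - 1%:M) *m (h j - 1%:M) = 0) -> Sp g -> Sp g' ->
  (f *m rho g *m difference_operator rho (map h s) *m rho g' *m v) 0 0
    = nabla [seq g *m (h i - 1%:M) *m g' | i <- s] (Sp_poly a) (g *m g')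
      * coefficient rho v f 1%:M.
Proof.
move=> us hS hh gS gS'; elim: s us g gS => [|i s IH] /=.
  move=> _ g gS; have ggS := SpM gS gS'.
  by rewrite mulmx1 -(mulmxA f) -(rhoM hrho gS gS') -(coefficientE hrho vU vT fL ggS).
move=> /andP[is_ us] g gS; have ghS := SpM gS (hS i).
rewrite mulmxA mulmxBr mulmx1 -(mulmxA f) -(rhoM hrho gS (hS i)).
rewrite !mulmxBl [LHS]mxE [X in _ + X]mxE !IH // [RHS]mulrBl.
congr (_ * _ - _).
have -> : g *m h i *m g' = g *m g' + g *m (h i - 1%:M) *m g'.
  by rewrite mulmxBr mulmx1 mulmxBl addrC subrK.
congr nabla; apply/eq_in_map => j js.
have ij : i != j by apply: contraNneq is_ => ->.
congr (_ *m _); rewrite -mulmxA; congr (_ *m _); apply/eqP; rewrite -subr_eq0.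
by rewrite -{2}[h j - _]mul1mx -mulmxBl hh.
Qed.

Lemma difference_operator0 (h : 'I_k -> 'M[F]_(n + n)) :
  (\sum_(i < n) a i * i.+1 < k)%N -> (forall i, Sp_factor U i (h i)) ->
  difference_operator rho [seq h i | i <- enum 'I_k] = 0.
Proof.
move=> ak hH; apply: (mx_pairing0 hrho hirr v0 f0) => g g' gS gS'.
have hS i : Sp (h i) := Sp_factor_Sp (hH i).
have hh i j : i != j -> (h i - 1%:M) *m (h j - 1%:M) = 0.
  by move=> ij; apply: (Sp_factor_sub_mul hU ij (hH i) (hH j)).
rewrite (coefficient_nabla (enum_uniq 'I_k) hS hh gS gS').
rewrite (nabla_comp _ _ _ ulsubmxD).
rewrite (homogeneous_degree_lt (homogeneous_highest_weight_poly F a)) ?mul0r //.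
by rewrite size_map size_map size_enum_ord.
Qed.

End Irreducible.

End Vanishing.

(** * Torsion elements and nilpotence *)

Section CompositionSeries.

Variables (F : fieldType) (n d : nat) (rho : 'M[F]_(n + n) -> 'M[F]_d).
Variable K : 'M[F]_(n + n) -> Prop.

Lemma stable0 : stable rho K 0%VS.
Proof. by move=> g _ v; rewrite !memv0 => /eqP ->; rewrite mulmx0. Qed.

(** Starting from 0, a proper stable subspace is enlarged as long as possible; the dimension of [W]
    bounds the number of steps. *)
Lemma exists_maximal_stable (W : {vspace 'cV[F]_d}) : W != 0%VS ->
  exists W', stable rho K W' /\ simple_quotient rho K W' W.
Proof.
move=> W0.
suff H : forall m W', stable rho K W' -> (W' <= W)%VS -> W' != W ->
    (\dim W - \dim W' <= m)%N ->
    exists W', stable rho K W' /\ simple_quotient rho K W' W.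
  by apply: (H (\dim W) 0%VS); rewrite ?sub0v ?leq_subr 1?eq_sym //; apply: stable0.
elim=> [|m IH] W' W'S W'W W'nW dW.
  case/eqP: W'nW; apply/eqP; rewrite eqEdim W'W.
  by move: dW; rewrite leqn0 subn_eq0.
have [[X [XS W'X XW XnW' XnW]]|no] := classic (exists X, [/\ stable rho K X, (W' <= X)%VS,
    (X <= W)%VS, X != W' & X != W]); last first.
  exists W'; split => //; split => // X XS W'X XW.
  have [->|XnW'] := eqVneq X W'; first by left.
  have [->|XnW] := eqVneq X W; first by right.
  by case: no; exists X.
apply: (IH X) => //; rewrite -ltnS (leq_trans _ dW) // ltn_sub2l //.
  rewrite ltn_neqAle dimvS // andbT; apply: contraNneq W'nW => dE.
  by rewrite eqEdim W'W dE leqnn.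
rewrite ltn_neqAle dimvS // andbT; apply: contraNneq XnW' => dE.
by rewrite eq_sym eqEdim W'X dE leqnn.
Qed.

Lemma exists_composition_series : exists m c, composition_series rho K m c.
Proof.
suff H : forall e (W : {vspace 'cV[F]_d}), stable rho K W -> (\dim W <= e)%N ->
    exists m, exists c : nat -> {vspace 'cV[F]_d},
    [/\ c 0%N = 0%VS, c m = W, forall j, (j <= m)%N -> stable rho K (c j)
      & forall j, (j < m)%N -> simple_quotient rho K (c j) (c j.+1)].
  have [|m [c [c0 cm cS cQ]]] := H _ fullv _ (leqnn _).
    by move=> g _ v _; rewrite memvf.
  by exists m, c.
elim=> [|e IH] W WS dW.
  exists 0%N, (fun=> 0%VS); split=> //; last by move=> j _; apply: stable0.
  by apply/esym/eqP; rewrite -dimv_eq0 -leqn0.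
have [->|W0] := eqVneq W 0%VS.
  by exists 0%N, (fun=> 0%VS); split=> // j _; apply: stable0.
have [W' [W'S W'Q]] := exists_maximal_stable W0.
have [W'W W'nW _] := W'Q.
have [|m [c [c0 cm cS cQ]]] := IH W' W'S.
  rewrite -ltnS (leq_trans _ dW) // ltn_neqAle dimvS // andbT.
  by apply: contraNneq W'nW => dE; rewrite eqEdim W'W dE leqnn.
exists m.+1, (fun j => if (j <= m)%N then c j else W); split => //.
- by rewrite ltnn.
- by move=> j _; case: ifP => // /cS.
move=> j; rewrite ltnS => jm; rewrite jm.
move: jm; rewrite leq_eqVlt => /orP[/eqP ->|jm]; first by rewrite ltnn cm.
by rewrite jm; apply: cQ.
Qed.

End CompositionSeries.

(** * Semisimplicity of the eigenvalue 0 *)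

Section Semisimple.

Variables (F : fieldType) (d : nat).
Implicit Types (X Y : 'M[F]_d).

(* The eigenvalue 0 of [X] is semisimple. *)
Definition kernel_stabilizes X : Prop :=
  forall w : 'cV[F]_d, X *m (X *m w) = 0 -> X *m w = 0.

Lemma kernel_stabilizesM X Y : X *m Y = Y *m X ->
  kernel_stabilizes X -> kernel_stabilizes Y -> kernel_stabilizes (X *m Y).
Proof.
move=> XY kX kY w; rewrite -!mulmxA.
have -> : X *m (Y *m (X *m (Y *m w))) = X *m (X *m (Y *m (Y *m w))).
  by congr (X *m _); rewrite mulmxA -XY -mulmxA.
move/kX; have -> : X *m (Y *m (Y *m w)) = Y *m (Y *m (X *m w)).
  by rewrite mulmxA XY -mulmxA; congr (Y *m _); rewrite mulmxA XY -mulmxA.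
by move/kY => YX; rewrite mulmxA XY -mulmxA.
Qed.

(** By induction [X] kills [X *m w], which lies one step lower, and then semisimplicity gives
    [X *m w = 0]. *)
Lemma kernel_stabilizes_filtration X (m : nat) (c : nat -> {vspace 'cV[F]_d}) :
  kernel_stabilizes X -> c 0%N = 0%VS ->
  (forall j w, (j < m)%N -> w \in c j.+1 -> X *m w \in c j) ->
  forall w, w \in c m -> X *m w = 0.
Proof.
move=> kX c0 cX w.
suff H j : (j <= m)%N -> forall w, w \in c j -> X *m w = 0 by apply: H.
elim: j => [|j IH] jm {}w.
  by rewrite c0 memv0 => /eqP ->; rewrite mulmx0.
by move=> /(cX _ _ jm)/(IH (ltnW jm)); apply: kX.
Qed.

End Semisimple.

(** * Rank one tori *)

Section TorusElements.

Variables (F : fieldType) (n : nat).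

Definition coordinate_torus (i : 'I_n) (z : F) : 'rV[F]_n :=
  \row_j (if j == i then z else 1).

Lemma coordinate_torus_neq0 i z : z != 0 -> forall j, coordinate_torus i z 0 j != 0.
Proof. by move=> z0 j; rewrite mxE; case: (j == i); rewrite ?oner_neq0. Qed.

Lemma torus_eltM (s t : 'rV[F]_n) :
  torus_elt s *m torus_elt t = torus_elt (\row_i (s 0 i * t 0 i)).
Proof.
rewrite !torus_eltE mulmx_block !mul0mx !mulmx0 !addr0 add0r !mulmx_diag.
congr block_mx; congr diag_mx; apply/rowP => i; rewrite !mxE //.
by rewrite invfM.
Qed.

Lemma coordinate_torusM i (y z : F) :
  torus_elt (coordinate_torus i y) *m torus_elt (coordinate_torus i z)
    = torus_elt (coordinate_torus i (y * z)).
Proof.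
rewrite torus_eltM; congr torus_elt; apply/rowP => j; rewrite !mxE.
by case: eqP => // _; rewrite mulr1.
Qed.

Lemma coordinate_torus1 i : torus_elt (coordinate_torus i 1) = 1%:M :> 'M[F]_(n + n).
Proof.
rewrite torus_eltE [RHS]scalar_mx_block -diag_const_mx; congr block_mx.
  by congr diag_mx; apply/rowP => j; rewrite !mxE; case: eqP.
by congr diag_mx; apply/rowP => j; rewrite !mxE; case: eqP; rewrite invr1.
Qed.

Lemma sform_std_f (u : 'cV[F]_(n + n)) i : sform u (std_f F i) = u (lshift n i) 0.
Proof.
rewrite /sform -colE mxE -[u]vsubmxK tr_col_mx witt_gramE mul_row_block.
rewrite row_mxEr mulmx0 addr0 mul_flip rev_ordK mxE.
by rewrite col_mxEu.
Qed.

Lemma sform_std_e (u : 'cV[F]_(n + n)) i :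
  sform (std_e F i) u = u (rshift n (rev_ord i)) 0.
Proof.
rewrite sformC /sform -colE mxE -[u]vsubmxK tr_col_mx witt_gramE mul_row_block.
rewrite row_mxEl mulmx0 add0r mulmxN mxE mul_flip mxE opprK.
by rewrite col_mxEd.
Qed.

(** Written in terms of the form and one hyperbolic pair only, so that it can be transported by a
    symplectic conjugation. *)
Lemma coordinate_torus_sub i z (u : 'cV[F]_(n + n)) :
  torus_elt (coordinate_torus i z) *m u
    = u + ((z - 1) * sform u (std_f F i)) *: std_e F i
        + ((z^-1 - 1) * sform (std_e F i) u) *: std_f F i.
Proof.
rewrite sform_std_f sform_std_e /torus_elt mul_diag_mx; apply/colP => r.
rewrite [LHS]mxE; set c := (z - 1) * _; set c' := (z^-1 - 1) * _.
have -> : (u + c *: std_e F i + c' *: std_f F i) r 0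
    = u r 0 + c * (r == lshift n i)%:R + c' * (r == rshift n (rev_ord i))%:R.
  by rewrite !mxE eqxx !andbT.
rewrite {}/c {}/c'; case: (split_ordP r) => s ->.
  rewrite row_mxEl mxE eq_lshift eq_lrshift mulr0 addr0.
  case: eqP => [->|_]; last by rewrite mul1r mulr0 addr0.
  by rewrite mulr1 mulrBl mul1r addrC subrK.
rewrite row_mxEr !mxE eq_rlshift eq_rshift mulr0 addr0 (can2_eq rev_ordK rev_ordK).
case: eqP => [->|_]; last by rewrite invr1 mul1r mulr0 addr0.
by rewrite mulr1 mulrBl mul1r addrC subrK.
Qed.

End TorusElements.

(** * A torus adapted to the decomposition *)

Section AdaptedTorus.

Variables (F : fieldType) (n k : nat) (ns : 'I_k -> nat).
Variable U : 'I_k -> {vspace 'cV[F]_(n + n)}.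
Hypotheses (hU : orthogonal_decomposition ns U) (ns0 : forall i, (0 < ns i)%N).
Hypothesis kn : (k <= n)%N.

Lemma hyperbolic_pair i : exists p : 'cV[F]_(n + n) * 'cV[F]_(n + n),
  [/\ p.1 \in U i, p.2 \in U i & sform p.1 p.2 = 1].
Proof.
have eU := memv_pick (U i); set e := vpick (U i) in eU.
have e0 : e != 0.
  by rewrite vpick0 -dimv_eq0 (od_dim hU) -lt0n muln_gt0 ns0.
have [w [wU ew]] : exists w, w \in U i /\ sform e w <> 0.
  apply: NNPP => no; case/eqP: e0; apply: (od_nondegenerate hU eU) => w wU.
  by apply: NNPP => ew; case: no; exists w.
exists (e, (sform e w)^-1 *: w); split=> //=; first by rewrite rpredZ.
by rewrite sformZr mulVf //; apply/eqP.
Qed.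

Lemma adapted_symplectic : exists2 x : 'M[F]_(n + n), Sp x &
  forall i : 'I_k, x *m std_e F (widen_ord kn i) \in U i
                   /\ x *m std_f F (widen_ord kn i) \in U i.
Proof.
have /fin_all_exists[p pE] := hyperbolic_pair.
(* The default 0, for indices from [k] on, is outside the range of the Witt extension. *)
pose e (i : 'I_n) := if insub (i : nat) is Some j then (p j).1 else 0.
pose f (i : 'I_n) := if insub (i : nat) is Some j then (p j).2 else 0.
have insubE (i : 'I_k) : insub (widen_ord kn i : nat) = Some i by rewrite valK.
have [i j ik jk|l lE] := @witt_extension F n k e f.
  rewrite /e /f !insubT; set i' := Sub _ _; set j' := Sub _ _.
  have ij : (i == j) = (i' == j') by [].
  have [pi qi piqi] := pE i'; have [pj qj pjqj] := pE j'.
  rewrite ij; case: eqVneq => [<-|i'j'].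
    by rewrite !sform_alt.
  by rewrite !(od_orthogonal hU i'j').
exists (transvections l 1) => [|i]; first exact: transvections_Sp.
have [-> ->] := lE (widen_ord kn i) (ltn_ord i).
by rewrite /e /f insubE; have [] := pE i.
Qed.

Definition conj_torus (x : 'M[F]_(n + n)) (i : 'I_n) (z : F) : 'M[F]_(n + n) :=
  x *m torus_elt (coordinate_torus i z) *m spinv x.

Lemma conj_torus_Sp x i z : Sp x -> z != 0 -> Sp (conj_torus x i z).
Proof.
move=> xS z0; apply: SpM (Sp_inv xS); apply: SpM => //.
exact/torus_elt_Sp/coordinate_torus_neq0.
Qed.

Lemma conj_torusM x i y z : Sp x ->
  conj_torus x i y *m conj_torus x i z = conj_torus x i (y * z).
Proof.
move=> xS; rewrite /conj_torus -coordinate_torusM.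
by rewrite !mulmxA -(mulmxA _ (spinv x) x) spinvK // mulmx1.
Qed.

Lemma conj_torus1 x i : Sp x -> conj_torus x i 1 = 1%:M.
Proof. by move=> xS; rewrite /conj_torus coordinate_torus1 mulmx1 spinvKr. Qed.

Lemma conj_torus_factor x i z : Sp x -> z != 0 ->
  x *m std_e F (widen_ord kn i) \in U i -> x *m std_f F (widen_ord kn i) \in U i ->
  Sp_factor U i (conj_torus x (widen_ord kn i) z).
Proof.
move=> xS z0 eU fU.
have hE w : conj_torus x (widen_ord kn i) z *m w
    = w + ((z - 1) * sform w (x *m std_f F (widen_ord kn i)))
            *: (x *m std_e F (widen_ord kn i))
        + ((z^-1 - 1) * sform (x *m std_e F (widen_ord kn i)) w)
            *: (x *m std_f F (widen_ord kn i)).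
  rewrite /conj_torus -!mulmxA coordinate_torus_sub !mulmxDr -!scalemxAr.
  rewrite mulmxA spinvKr // mul1mx sform_inv //; congr (_ + (_ * _) *: _).
  by rewrite -(sform_Sp _ _ xS) mulmxA spinvKr // mul1mx.
split=> [|w wi|j ji w wj]; first exact: conj_torus_Sp.
  by rewrite hE rpredD ?rpredZ // rpredD ?rpredZ.
rewrite hE (od_orthogonal hU ji wj fU) (od_orthogonal hU _ eU wj) 1?eq_sym //.
by rewrite !mulr0 !scale0r !addr0.
Qed.

End AdaptedTorus.

(** * Vanishing of the difference operator at torsion elements *)

Section NonVanishing.

Variables (F : closedFieldType) (n k d : nat) (ns : 'I_k -> nat).
Variable U : 'I_k -> {vspace 'cV[F]_(n + n)}.
Hypotheses (hU : orthogonal_decomposition ns U) (ns0 : forall i, (0 < ns i)%N).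
Hypothesis kn : (k <= n)%N.
Variable rho : 'M[F]_(n + n) -> 'M[F]_d.
Hypothesis hrho : rational_representation rho.

Lemma torsion_neq0 (z : F) : torsion z -> z != 0.
Proof.
move=> [r r0 zr]; apply: contra_eq_neq zr => ->.
by rewrite expr0n; case: r r0 => [|r _]; rewrite ?eqxx // eq_sym oner_neq0.
Qed.

(* If [(rho g - 1)^2] kills [w] then [rho g ^ r w = w + r (rho g w - w)]; take for
   [r] an exponent of [z], which is invertible in [F]. *)
Lemma torsion_kernel_stabilizes x (i : 'I_n) z : Sp x -> torsion z ->
  kernel_stabilizes (rho (conj_torus x i z) - 1%:M).
Proof.
move=> xS zt w; have z0 := torsion_neq0 zt; set g := conj_torus x i z.
have [r r0 zr] := zt; set y := (rho g - 1%:M) *m w => gy.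
have {gy} gy : rho g *m y = y.
  by apply/eqP; rewrite -subr_eq0; move/eqP: gy; rewrite mulmxBl mul1mx.
have gw : rho g *m w = w + y by rewrite /y mulmxBl mul1mx addrC subrK.
have pw m : rho (conj_torus x i (z ^+ m)) *m w = w + m%:R *: y.
  elim: m => [|m IH].
    by rewrite expr0 conj_torus1 // (rho1 hrho) mul1mx scale0r addr0.
  have gmS : Sp (conj_torus x i (z ^+ m)) by exact: conj_torus_Sp xS (expf_neq0 m z0).
  have gS : Sp g by apply: conj_torus_Sp.
  rewrite exprS -conj_torusM // (rhoM hrho gS gmS) -mulmxA IH mulmxDr gw.
  by rewrite -scalemxAr gy mulrS scalerDl scale1r addrA.
have := pw r; rewrite zr conj_torus1 // (rho1 hrho) mul1mx => /eqP.
rewrite -[X in X == _]addr0 (inj_eq (addrI w)) eq_sym scaler_eq0.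
by rewrite (negPf r0) => /eqP.
Qed.

Lemma difference_operator_torsion0 x (z : 'I_k -> F) : Sp x ->
  (forall i : 'I_k, x *m std_e F (widen_ord kn i) \in U i
                   /\ x *m std_f F (widen_ord kn i) \in U i) ->
  (forall W' W : {vspace 'cV[F]_d},
     composition_factor rho (Sp_product U) W' W ->
     exists i : 'I_k, acts_trivially rho (Sp_factor U i) W' W) ->
  (forall i, torsion (z i)) ->
  difference_operator rho
    [seq conj_torus x (widen_ord kn i) (z i) | i <- enum 'I_k] = 0.
Proof.
move=> xS xU triv zt; pose h (i : 'I_k) := conj_torus x (widen_ord kn i) (z i).
have hF i : Sp_factor U i (h i).
  by have [eU fU] := xU i; apply: (conj_torus_factor hU xS (torsion_neq0 (zt i)) eU fU).
have hk i : kernel_stabilizes (rho (h i) - 1%:M) by apply: torsion_kernel_stabilizes.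
rewrite -[[seq _ | i <- _]]/(map h (enum 'I_k)); clearbody h.
have hP i : Sp_product U (h i) := Sp_factor_product (hF i).
have hS i : Sp (h i) := Sp_factor_Sp (hF i).
have hC i j : (rho (h i) - 1%:M) *m (rho (h j) - 1%:M)
            = (rho (h j) - 1%:M) *m (rho (h i) - 1%:M).
  have [->//|ij] := eqVneq i j.
  (* Expanding [(h l - 1) (h l' - 1) = 0] gives an expression symmetric in [l] and [l'], whence
     commutation. *)
  have hE l l' : l != l' -> h l *m h l' = h l + (h l' - 1%:M).
    move=> /(fun ll => Sp_factor_sub_mul hU ll (hF l) (hF l')) /eqP.
    by rewrite mulmxBl mulmxBr mulmx1 mul1mx subr_eq0 subr_eq addrC => /eqP.
  have hh : h i *m h j = h j *m h i 
    by rewrite (hE _ _ ij) (hE j i) 1?eq_sym // !addrA (addrC (h i)).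
  rewrite !mulmxBl !mulmxBr !mulmx1 !mul1mx.
  rewrite -(rhoM hrho (hS i) (hS j)) -(rhoM hrho (hS j) (hS i)) hh.
  by rewrite !opprB addrACA [RHS]addrACA; congr (_ + _); rewrite addrC.
have DC s i : (rho (h i) - 1%:M) *m difference_operator rho (map h s)
            = difference_operator rho (map h s) *m (rho (h i) - 1%:M).
  elim: s => [|j s IH] /=; first by rewrite mul1mx mulmx1.
  by rewrite mulmxA hC -!mulmxA IH.
have Dk s : kernel_stabilizes (difference_operator rho (map h s)).
  elim: s => [|i s IH] /=; first by move=> w; rewrite !mul1mx.
  exact: kernel_stabilizesM.
have [m [c cs]] := exists_composition_series rho (Sp_product U).
(* The difference for the index [i] acting trivially maps [c j.+1] into [c j]; all the others
   preserve both. *)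
have Dc j w : (j < m)%N -> w \in c j.+1 ->
    difference_operator rho (map h (enum 'I_k)) *m w \in c j.
  move=> jm wc; have [|i iT] := triv (c j) (c j.+1); first by exists m, c, j.
  have st l s u : (l <= m)%N -> u \in c l ->
      difference_operator rho (map h s) *m u \in c l.
    move=> lm; apply: difference_operator_mem => _ /mapP[r _ ->] y.
    exact: (cs_stable cs lm (hP r)).
  have : i \in enum 'I_k by rewrite mem_enum.
  elim: (enum 'I_k) => //= r s IH; rewrite -mulmxA mulmxBl mul1mx.
  rewrite inE => /orP[/eqP <-|/IH Dw]; first exact: iT (hF i) _ (st _ _ _ jm wc).
  by rewrite rpredB //; apply: (cs_stable cs (ltnW jm) (hP r)).
have D0 (w : 'cV[F]_d) : difference_operator rho (map h (enum 'I_k)) *m w = 0.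
  apply: (kernel_stabilizes_filtration (Dk (enum 'I_k)) (cs_bottom cs) Dc).
  by rewrite (cs_top cs) memvf.
apply/matrixP => r s; have := D0 (delta_mx s 0); rewrite -colE => /matrixP/(_ r 0).
by rewrite !mxE.
Qed.

End NonVanishing.

(** * Density arguments *)

Section PolynomialExtension.

Variables (F : closedFieldType) (n : nat).
Implicit Types (f : 'M[F]_n -> F) (A B : 'M[F]_n).

(** Polynomiality on matrices, tested on curves only; differences inherit it. *)
Definition polynomial_on_curves f : Prop :=
  forall M : F -> 'M[F]_n, polymx M -> polyfun (fun z => f (M z)).

Lemma nabla_polynomial_on_curves l f :
  polynomial_on_curves f -> polynomial_on_curves (nabla l f).
Proof.
move=> pf M pM; elim: l M pM => [|d l IH] M pM /=; first exact: pf.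
apply: polyfunD; last exact/polyfunN/IH.
by apply: (IH (fun z => M z + d)); apply: polymxD => //; apply: polymx_cst.
Qed.

(** One parameter at a time: with the others fixed, the difference is a polynomial in [z i] that
    vanishes at all torsion values. *)
Lemma nabla_torsion_extend (I : eqType) (s : seq I) (R : I -> 'M[F]_n) f x :
  uniq s -> polynomial_on_curves f ->
  (forall z : I -> F, (forall i, torsion (z i)) ->
     nabla [seq (z i - 1) *: R i | i <- s] f x = 0) ->
  forall z : I -> F, nabla [seq (z i - 1) *: R i | i <- s] f x = 0.
Proof.
elim: s f => [|i s IH] f.
  move=> _ _ /(_ (fun=> 1)) /= f0 _; apply: f0 => _.
  by exists 1%N; rewrite ?oner_neq0 ?expr1n.
rewrite [uniq _]/= => /andP[is_ us] pf f0 z.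
pose g c := nabla [seq (z j - 1) *: R j | j <- s] f (x + (c - 1) *: R i)
            - nabla [seq (z j - 1) *: R j | j <- s] f x.
rewrite -[LHS]/(g (z i)); apply: polyfun_torsion_eq0 => [|c ct].
  apply: polyfunD; last exact: polyfun_cst.
  apply: (nabla_polynomial_on_curves _ pf (M := fun c => x + (c - 1) *: R i)).
  apply: polymxD; first exact: polymx_cst.
  apply: polymxZ; last exact: polymx_cst.
  by apply: polyfunD; [exact: polyfun_id|exact: polyfun_cst].
rewrite /g -[LHS]/(nabla ((c - 1) *: R i :: _) f x) nabla_cons.
apply: IH => // [M pM|z' z't].
  apply: polyfunD; last exact/polyfunN/pf.
  by apply: (pf (fun t => M t + _)); apply: polymxD => //; apply: polymx_cst.
rewrite -nabla_cons; have := f0 (fun j => if j == i then c else z' j).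
rewrite /= eqxx.
have -> : [seq ((if j == i then c else z' j) - 1) *: R j | j <- s]
        = [seq (z' j - 1) *: R j | j <- s].
  by apply/eq_in_map => j js; case: eqP => // ji; rewrite -ji js in is_.
by apply=> j; case: eqP.
Qed.

(* [1 + z (A - 1)] joins the identity to [A]. *)
Lemma unitmx_curves (f : 'M[F]_n -> 'M[F]_n -> F) :
  (forall M N : F -> 'M[F]_n, polymx M -> polymx N -> polyfun (fun z => f (M z) (N z))) ->
  (forall A B, A \in unitmx -> B \in unitmx -> f A B = 0) -> forall A B, f A B = 0.
Proof.
move=> pf f0 A B; pose c (M : 'M[F]_n) z := 1%:M + z *: (M - 1%:M).
have pc M : polymx (c M).
  apply: polymxD; first exact: polymx_cst.
  by apply: polymxZ; [exact: polyfun_id|exact: polymx_cst].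
have c1 M : c M 1 = M by rewrite /c scale1r addrC subrK.
rewrite -[A]c1 -[B]c1.
apply: (polyfun_eq0 (f := fun z => f (c A z) (c B z))
                    (g := fun z => \det (c A z) * \det (c B z))).
- exact: pf.
- by apply: polyfunM; apply: polyfun_det.
- by exists 0; rewrite /c !scale0r !addr0 det1 mulr1 oner_neq0.
by move=> z; rewrite mulf_eq0 negb_or => /andP[Az Bz]; apply: f0; rewrite unitmxE unitfE.
Qed.

Lemma polynomial_on_curves_nabla f (ds : seq (F -> 'M[F]_n)) (M : F -> 'M[F]_n) :
  polynomial_on_curves f -> polymx M -> (forall e, List.In e ds -> polymx e) ->
  polyfun (fun z => nabla [seq e z | e <- ds] f (M z)).
Proof.
move=> pf pM pds; apply: (@polyfun_nabla F _ (@polymx F n n)) => // N N'.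
exact: polymxD.
Qed.

End PolynomialExtension.

(** * The Levi subgroup [GL_n] *)

Section LeviSubgroup.

Variables (F : fieldType) (n : nat).
Implicit Types A B : 'M[F]_n.

Definition levi A : 'M[F]_(n + n) :=
  block_mx A 0 0 (flip_mx F n *m (invmx A)^T *m flip_mx F n).

Lemma levi_Sp A : A \in unitmx -> Sp (levi A).
Proof.
move=> AU; apply: Sp_block_diag.
rewrite -!mulmxA (mulmxA (flip_mx F n)) flip_mxK mul1mx mulmxA -trmx_mul mulVmx //.
by rewrite trmx1 mul1mx.
Qed.

Lemma ulsubmx_leviM A B : ulsubmx (levi A *m levi B) = A *m B.
Proof. by rewrite mulmx_block block_mxKul mul0mx addr0. Qed.

Lemma ulsubmx_levi_torus A B i z :
  ulsubmx (levi A *m (torus_elt (coordinate_torus i z) - 1%:M) *m levi B)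
    = (z - 1) *: rank_one (col i A, row i B).
Proof.
rewrite torus_eltE [1%:M]scalar_mx_block opp_block_mx add_block_mx !mulmx_block block_mxKul.
rewrite !(mul0mx, mulmx0, oppr0, addr0).
have -> : diag_mx (coordinate_torus i z) - 1%:M = (z - 1) *: delta_mx i i.
  apply/matrixP => r s; rewrite !mxE; case: (eqVneq r s) => [<-|rs].
    by rewrite andbb; case: eqP; rewrite /= ?mulr1 ?mulr0 ?subrr.
  rewrite subr0; case: (eqVneq r i) => [ri|_]; rewrite ?mulr0 //=.
  by rewrite -ri eq_sym (negPf rs) mulr0.
by rewrite -scalemxAr -scalemxAl -(mul_delta_mx (0 : 'I_1)) !mulmxA -colE -mulmxA -rowE.
Qed.

Lemma mulmx_rank_one A B : A *m B = \sum_i rank_one (col i A, row i B).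
Proof.
apply/matrixP => r s; rewrite mxE summxE; apply: eq_bigr => i _.
by rewrite mxE big_ord1 !mxE.
Qed.

End LeviSubgroup.

(** Torsion values and then invertibility are removed by density. Any list of at most [n] rank one
    matrices arises from the columns of some [A] and the rows of some [B]: the first [k] are
    directions, the others sum to the base point. *)
Lemma nabla_rank_one_lists (F : closedFieldType) (n k : nat) (kn : (k <= n)%N)
    (f : 'M[F]_n -> F) :
  polynomial_on_curves f ->
  (forall (A B : 'M[F]_n) (z : 'I_k -> F), A \in unitmx -> B \in unitmx ->
     (forall i, torsion (z i)) ->
     nabla [seq (z i - 1) *: rank_one (col (widen_ord kn i) A, row (widen_ord kn i) B)
           | i <- enum 'I_k] f (A *m B) = 0) ->
  forall L1 L2 : seq ('cV[F]_n * 'rV[F]_n), size L1 = k -> (size L1 + size L2 <= n)%N ->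
    nabla (map (@rank_one F n) L1) f (\sum_(p <- L2) rank_one p) = 0.
Proof.
move=> pf f0.
pose R (A B : 'M[F]_n) (j : 'I_n) := rank_one (col j A, row j B).
pose T (A B : 'M[F]_n) := nabla [seq R A B (widen_ord kn i) | i <- enum 'I_k] f
                            (\sum_(j < n | (k <= j)%N) R A B j).
have pR (M N : F -> 'M[F]_n) j : polymx M -> polymx N -> polymx (fun z => R (M z) (N z) j).
  move=> pM pN; apply: polymxM => r s.
    by apply: polyfun_ext (pM r j) => z; rewrite !mxE.
  by apply: polyfun_ext (pN j s) => z; rewrite !mxE.
have T0 A B : T A B = 0.
  apply: unitmx_curves => [M N pM pN|{}A {}B AU BU].
    apply: (@polyfun_ext _ (fun z => nabla
       [seq e z | e <- [seq (fun z => R (M z) (N z) (widen_ord kn i)) | i <- enum 'I_k]] f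
       (\sum_(j < n | (k <= j)%N) R (M z) (N z) j))).
      by move=> z; rewrite /T -map_comp.
    apply: polynomial_on_curves_nabla => // [r s|e].
      apply: (@polyfun_ext _ (fun z => \sum_(j < n | (k <= j)%N) R (M z) (N z) j r s)).
        by move=> z; rewrite summxE.
      by apply: polyfun_sum => j _; apply: pR.
    by rewrite List.in_map_iff => -[i [<- _]]; apply: pR.
  (* At [z = 0] the directions are the opposites of the [R A B i]; reversing them moves the base
     point from [A *m B] to the sum over [j >= k]. *)
  have := nabla_torsion_extend (enum_uniq 'I_k) pf (fun z => f0 A B z AU BU) (fun=> 0).
  have -> : [seq (0 - 1) *: rank_one (col (widen_ord kn i) A, row (widen_ord kn i) B)
            | i <- enum 'I_k] = map -%R [seq R A B (widen_ord kn i) | i <- enum 'I_k].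
    by rewrite -[RHS]map_comp; apply/eq_in_map => i _; rewrite sub0r scaleN1r.
  have -> : A *m B = \sum_(j < n | (k <= j)%N) R A B j
                   + \sum_(d <- [seq R A B (widen_ord kn i) | i <- enum 'I_k]) d.
    rewrite mulmx_rank_one big_map big_enum /= (bigID (fun j : 'I_n => k <= j)%N) /=.
    congr (_ + _); rewrite -(big_ord_narrow kn (F := R A B)).
    by apply: eq_bigl => j; rewrite -ltnNge.
  by rewrite nabla_opp => /eqP; rewrite mulf_eq0 signr_eq0 => /eqP.
move=> L1 L2 L1k L12.
(* Beyond the length of [L], the default of [nth] makes the columns of [A] and the rows of [B]
   zero. *)
pose L := L1 ++ L2; pose G j := rank_one (nth (0, 0) L j).
pose A : 'M[F]_n := \matrix_(r, j) (nth (0, 0) L j).1 r 0.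
pose B : 'M[F]_n := \matrix_(j, s) (nth (0, 0) L j).2 0 s.
have RG j : R A B j = G j.
  rewrite /R /G [nth _ _ _]surjective_pairing; congr (rank_one (_, _)).
    by apply/colP => r; rewrite !mxE.
  by apply/rowP => s; rewrite !mxE.
have := T0 A B; rewrite /T (eq_bigr (fun j : 'I_n => G j)) => [|j _]; last exact: RG.
have -> : [seq R A B (widen_ord kn i) | i <- enum 'I_k] = map (@rank_one F n) L1.
  rewrite (eq_map (fun i => RG _)) (map_comp G (@nat_of_ord k)) val_enum_ord -L1k.
  rewrite -[L1 in RHS](mkseq_nth (0, 0)) -map_comp; apply/eq_in_map => j.
  by rewrite mem_iota /= add0n => jL; rewrite /G nth_cat jL.
suff -> : \sum_(j < n | (k <= j)%N) G j = \sum_(p <- L2) rank_one p by [].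
rewrite -(big_mkord (fun j => k <= j)%N G) /= (big_cat_nat (leq0n k) kn) /=.
rewrite big_nat_cond big1 ?add0r => [|j /andP[/andP[_ jk]]]; last by rewrite leqNgt jk.
have -> : \sum_(k <= j < n | (k <= j)%N) G j = \sum_(k <= j < n) G j.
  rewrite [LHS]big_nat_cond [RHS]big_nat_cond; apply: eq_bigl => j.
  by case: (k <= j)%N; rewrite ?andbT ?andbF.
rewrite -L1k (big_cat_nat (leq_addr (size L2) _) L12) /=.
rewrite [X in _ + X]big_nat_cond [X in _ + X]big1 ?addr0 => [|j]; last first.
  rewrite andbT => /andP[Lj _]; rewrite /G nth_default ?size_cat //.
  by rewrite /rank_one mul0mx.
rewrite -{1}[size L1]add0n big_addn addKn (big_nth (0, 0)).
by apply: eq_bigr => j _; rewrite /G nth_cat ltnNge leq_addl /= addnK.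
Qed.

Lemma fact_neq0_pchar (F : fieldType) p m : has_characteristic F p ->
  ((0 < p)%N -> (m < p)%N) -> (m`!)%:R != 0 :> F.
Proof.
case=> [[-> F0] _|pF mp]; first by rewrite ((pcharf0P F).1 F0) -lt0n fact_gt0.
have p0 : (0 < p)%N by apply/prime_gt0/(pcharf_prime pF).
elim: m mp => [|m IH] mp; first by rewrite oner_neq0.
rewrite factS natrM mulf_neq0 ?IH // => [|_]; last exact: ltnW (mp p0).
by rewrite -(dvdn_pcharf pF) gtnNdvd // mp.
Qed.

Theorem theorem1p6 (F : closedFieldType) (p : nat)
  (hp : has_characteristic F p)
  (n k : nat) (hk : (0 < k)%N)
  (ns : 'I_k -> nat) (hns : forall i, (0 < ns i)%N)
  (hn : n = (\sum_(i < k) ns i)%N)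
  (U : 'I_k -> {vspace 'cV[F]_(n + n)})
  (hU : orthogonal_decomposition ns U)
  (d : nat) (rho : 'M[F]_(n + n) -> 'M[F]_d)
  (hrho : rational_representation rho)
  (hirr : irreducible_representation rho)
  (a : 'I_n -> nat)
  (ha : has_highest_weight rho a)
  (hres : p_restricted p a) :
  (forall W' W : {vspace 'cV[F]_d},
     composition_factor rho (Sp_product U) W' W ->
     exists i : 'I_k, acts_trivially rho (Sp_factor U i) W' W)
  <->
  (\sum_(i < n) a i * i.+1 < k)%N.
Proof.
have kn : (k <= n)%N.
  rewrite hn -[X in (X <= _)%N]card_ord -sum1_card; apply: leq_sum => i _.
  exact: hns.
have [v [v0 vU vT]] := ha.
have [f f0 fL] := lower_invariant hrho hirr.1.
split=> [triv|ak W' W cf]; last first.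
  apply: (acts_trivially_of_vanishing hU hrho cf) => h hH.
  exact: (difference_operator0 hU hrho hirr v0 f0 vU vT fL ak hH).
rewrite ltnNge; apply/negP => kD.
have [x xS xU] := adapted_symplectic hU hns kn.
have H0 (A B : 'M[F]_n) (z : 'I_k -> F) : A \in unitmx -> B \in unitmx ->
    (forall i, torsion (z i)) ->
    nabla [seq (z i - 1) *: rank_one (col (widen_ord kn i) A, row (widen_ord kn i) B)
          | i <- enum 'I_k] (highest_weight_poly a) (A *m B) = 0.
  move=> AU BU zt; have [AS BS] := (levi_Sp AU, levi_Sp BU).
  pose h (i : 'I_k) := conj_torus x (widen_ord kn i) (z i).
  have hF i : Sp_factor U i (h i).
    have [eU fU] := xU i.
    exact: (conj_torus_factor hU xS (torsion_neq0 (zt i)) eU fU).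
  have hS i : Sp (h i) := Sp_factor_Sp (hF i).
  have hh i j : i != j -> (h i - 1%:M) *m (h j - 1%:M) = 0.
    by move=> ij; apply: (Sp_factor_sub_mul hU ij (hF i) (hF j)).
  (* The factors [spinv x] and [x] undo the conjugation of the torus elements, leaving the Levi
     elements of [A] and [B] around the standard torus. *)
  have gS := SpM AS (Sp_inv xS); have gS' := SpM xS BS.
  have := coefficient_nabla hrho vU vT fL (enum_uniq 'I_k) hS hh gS gS'.
  rewrite (difference_operator_torsion0 hU hrho xS xU triv zt) mulmx0 !mul0mx mxE.
  move=> /esym/eqP; rewrite mulf_eq0.
  rewrite (negPf (coefficient1_neq0 hrho hirr v0 f0 vU vT fL)) orbF => /eqP.
  rewrite (nabla_comp _ _ _ (@ulsubmxD F n)).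
  have -> : levi A *m spinv x *m (x *m levi B) = levi A *m levi B.
    by rewrite -mulmxA (mulmxA (spinv x)) spinvK // mul1mx.
  rewrite ulsubmx_leviM -map_comp => <-; congr nabla; apply/eq_in_map => i _ /=.
  rewrite -ulsubmx_levi_torus; congr ulsubmx.
  rewrite -!mulmxA; congr (_ *m _); rewrite !mulmxA; congr (_ *m _).
  rewrite /h /conj_torus mulmxBr mulmxBl mulmx1 !mulmxA spinvK // mul1mx.
  by rewrite -mulmxA spinvK // mulmx1.
have pf : polynomial_on_curves (highest_weight_poly (F := F) a).
  by move=> M pM; apply: polyfun_highest_weight_poly.
(* Matrix units have rank one, so this annihilates the difference along the word [w], whose length
   is at least [k] by [kD]. *)
have N0 := nabla_rank_one0 kn (nabla_rank_one_lists pf H0).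
have [|w wD] := @nabla_highest_weight_poly F n a.
  by move=> i; apply: (fact_neq0_pchar hp) => p0; apply: hres.
have -> : map (@unit_mx F n) w
    = map (@rank_one F n) [seq (delta_mx q.1 0, delta_mx 0 q.2) | q <- w].
  by rewrite -map_comp; apply/eq_in_map => q _; rewrite /rank_one /= mul_delta_mx.
by rewrite N0 ?eqxx // size_map wD.
Qed.
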